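(* Let $(M, g(t))$, $t\in[0,T]$, be a solution to the Ricci flow $\frac{\partial g_{ij}}{\partial t} = -2R_{ij}$ on a manifold of dimension $n$, let $\tau = T-t$, let $c$ be a constant, and let $u$ satisfy $$\frac{\partial u}{\partial \tau} = \triangle u - |\nabla u|^2 - cR.$$ Let $$H=\alpha \triangle u-\beta|\nabla u|^2+aR+b\frac{u}{\tau}+d\frac{n}{\tau},$$ where $\alpha$, $\beta$, $a$, $b$ and $d$ are constants, and let $\lambda$ also be a constant. Then $H$ satisfies the evolution equation \begin{align*} \frac{\partial H}{\partial \tau}=&\ \triangle H-2\nabla H \cdot \nabla u-(2\alpha-2\beta)\left|\nabla \nabla u+\frac{\alpha}{2\alpha-2\beta}R_{ij}-\frac{\lambda}{2\tau}g_{ij}\right|^2 -\frac{2\alpha-2\beta}{\alpha} \frac{\lambda}{\tau}H\\ &-2(\alpha-2\beta) R_{ij}u_iu_j+2(a+\beta c) \nabla R \cdot \nabla u +(2\alpha-2\beta)\frac{n \lambda^2}{4\tau^2}\\ &+\left(b-\frac{2\alpha-2\beta}{\alpha} \lambda \beta\right)\frac{|\nabla u|^2}{\tau}-(\alpha c+2a) \triangle R+\left(\frac{\alpha^2}{2\alpha-2\beta}-2a\right)|Rc|^2\\ &+\left(\frac{2\alpha-2\beta}{\alpha} \lambda-1\right)b\frac{u}{\tau^2}+\left(\frac{2\alpha-2\beta}{\alpha} \lambda -1\right)d\frac{n}{\tau^2}+\left(\frac{2\alpha-2\beta}{\alpha} a \lambda-\alpha\lambda -bc\right)\frac{R}{\tau}.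 \end{align*}
   Context: All geometric quantities are taken with respect to the evolving metric $g(t)$: $Rc=(R_{ij})$ is the Ricci curvature, $R$ the scalar curvature, $\nabla$ the Levi-Civita connection, $\nabla\nabla u$ the Hessian, $u_i=\nabla_i u$, $\triangle$ the Laplace-Beltrami operator (trace of the Hessian), $|\cdot|$ and $\cdot$ the norm and inner product of $g(t)$; repeated indices are contracted with $g(t)$. $\frac{\partial}{\partial\tau}=-\frac{\partial}{\partial t}$. *)

(* Defs.v *)
From HB Require Import structures.
From mathcomp Require Import all_boot all_order all_algebra.
From mathcomp Require Import all_classical all_reals all_analysis.
Set Implicit Arguments.
Unset Strict Implicit.
Unset Printing Implicit Defensive.
Import Order.TTheory GRing.Theory Num.Theory.
Import numFieldNormedType.Exports.
Local Open Scope classical_set_scope.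
Local Open Scope ring_scope.

(* Coordinate charts are homeomorphisms from an open subset of M onto an open
   subset of R^n, so manifolds have no boundary. The maps are total; their
   values outside chart_dom, respectively chart_map @` chart_dom, are junk. *)
Record chart (R : realType) (n : nat) (M : topologicalType) := Chart {
  chart_dom : set M;
  chart_map :> M -> 'rV[R]_n;
  chart_inv : 'rV[R]_n -> M;
  chart_dom_open : open chart_dom;
  chart_img_open : open (chart_map @` chart_dom);
  chart_mapK : forall p, chart_dom p -> chart_inv (chart_map p) = p;
  chart_map_continuous : {within chart_dom, continuous chart_map};
  chart_inv_continuous :
    {within chart_map @` chart_dom, continuous chart_inv} }.

(* The coordinate vector field d/dx^i of phi, acting on functions on M. *)
Definition pd (R : realType) (n : nat) (M : topologicalType)
    (phi : chart R n M) (i : 'I_n) (f : M -> R) (p : M) : R :=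
  'D_(delta_mx 0 i) (f \o chart_inv phi) (phi p).

Definition has_pd (R : realType) (n : nat) (M : topologicalType)
    (phi : chart R n M) (i : 'I_n) (f : M -> R) (p : M) : Prop :=
  derivable (f \o chart_inv phi) (phi p) (delta_mx 0 i).

(* C^k on D, an open subset of the domain of phi: all iterated partial
   derivatives of order at most k exist and are continuous on D. *)
Fixpoint Ck_on (R : realType) (n : nat) (M : topologicalType)
    (phi : chart R n M) (D : set M) (k : nat) (f : M -> R) : Prop :=
  {within D, continuous f} /\
  match k with
  | 0%N => True
  | k'.+1 => forall i, (forall p, D p -> has_pd phi i f p) /\
                       Ck_on phi D k' (pd phi i f)
  end.

Definition smooth_on (R : realType) (n : nat) (M : topologicalType)
    (phi : chart R n M) (D : set M) (f : M -> R) : Prop :=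
  forall k, Ck_on phi D k f.

Record smooth_manifold (R : realType) (n : nat) (M : topologicalType) :=
  SmoothManifold {
  atlas : set (chart R n M);
  manifold_hausdorff : hausdorff_space M;
  manifold_second_countable : @second_countable M;
  atlas_cover : forall p, exists2 phi, atlas phi & chart_dom phi p;
  atlas_compatible : forall phi psi, atlas phi -> atlas psi ->
    forall i : 'I_n, smooth_on phi (chart_dom phi `&` chart_dom psi)
                       (fun p => psi p 0 i) }.

(* Time-dependent functions on M have type R -> M -> R, time first. Their time
   derivative is taken within [0, T], hence one-sided at both end points. *)
Definition ddt_quotient (R : realType) (M : Type) (f : R -> M -> R)
    (t : R) (p : M) (s : R) : R := (f s p - f t p) / (s - t).

Definition ddt (R : realType) (M : Type) (T : R) (f : R -> M -> R)
    (t : R) (p : M) : R :=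
  lim (ddt_quotient f t p @ within `[0, T] t^').

Definition has_ddt (R : realType) (M : Type) (T : R) (f : R -> M -> R)
    (t : R) (p : M) : Prop :=
  cvg (ddt_quotient f t p @ within `[0, T] t^').

(* Joint smoothness in time and space, for times in J (= [0, T] or [0, T[):
   all iterated mixed derivatives exist and are jointly continuous on
   J x chart_dom phi. *)
Fixpoint time_Ck_on (R : realType) (n : nat) (M : topologicalType)
    (phi : chart R n M) (T : R) (J : set R) (k : nat) (f : R -> M -> R)
    : Prop :=
  {within [set z : R * M | J z.1 /\ chart_dom phi z.2],
    continuous (fun z : R * M => f z.1 z.2)} /\
  match k with
  | 0%N => True
  | k'.+1 =>
      ((forall t p, J t -> chart_dom phi p -> has_ddt T f t p) /\
       time_Ck_on phi T J k' (ddt T f)) /\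
      (forall i,
        (forall t p, J t -> chart_dom phi p -> has_pd phi i (f t) p) /\
        time_Ck_on phi T J k' (fun t => pd phi i (f t)))
  end.

Definition time_smooth_on (R : realType) (n : nat) (M : topologicalType)
    (phi : chart R n M) (T : R) (J : set R) (f : R -> M -> R) : Prop :=
  forall k, time_Ck_on phi T J k f.

(* A smooth family g(t), t in [0, T], of Riemannian metrics, as a covariant
   2-tensor: g phi t p i j is g(t)(d/dx^i, d/dx^j) at p in the chart phi, and
   the components in two charts are related by the tensor transformation
   law. *)
Record metric_family (R : realType) (n : nat) (M : topologicalType)
    (X : smooth_manifold R n M) (T : R) := MetricFamily {
  metric :> chart R n M -> R -> M -> 'M[R]_n;
  metric_sym : forall phi t p, atlas X phi -> t \in `[0, T] ->
    chart_dom phi p -> (metric phi t p)^T = metric phi t p;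
  metric_posdef : forall phi t p, atlas X phi -> t \in `[0, T] ->
    chart_dom phi p -> forall v : 'rV[R]_n, v != 0 ->
    0 < (v *m metric phi t p *m v^T) 0 0;
  metric_smooth : forall phi, atlas X phi -> forall i j : 'I_n,
    time_smooth_on phi T `[0, T] (fun t p => metric phi t p i j);
  metric_transform : forall phi psi t p, atlas X phi -> atlas X psi ->
    t \in `[0, T] -> chart_dom phi p -> chart_dom psi p ->
    forall i j : 'I_n,
    metric phi t p i j =
      \sum_k \sum_l pd phi i (fun q => psi q 0 k) p *
                    pd phi j (fun q => psi q 0 l) p * metric psi t p k l }.

(* Geometry of a single metric in a chart; G p is the matrix (g_ij) of the
   metric at p and invmx (G p) is the matrix (g^ij). *)
Section Geometry.
Variables (R : realType) (n : nat) (M : topologicalType).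
Variables (phi : chart R n M) (G : M -> 'M[R]_n).

(* Gamma^k_ij of the Levi-Civita connection *)
Definition christoffel (k i j : 'I_n) (p : M) : R :=
  2^-1 * \sum_l invmx (G p) k l *
    (pd phi i (fun q => G q j l) p + pd phi j (fun q => G q i l) p
     - pd phi l (fun q => G q i j) p).

(* R(d_i, d_j) d_k = R^l_ijk d_l, with
   R(X, Y) Z = nabla_X nabla_Y Z - nabla_Y nabla_X Z - nabla_[X, Y] Z *)
Definition riemann (l i j k : 'I_n) (p : M) : R :=
  pd phi i (christoffel l j k) p - pd phi j (christoffel l i k) p
  + \sum_m (christoffel l i m p * christoffel m j k p
            - christoffel l j m p * christoffel m i k p).

(* Round spheres have positive Ricci curvature with these conventions. *)
Definition ricci (p : M) : 'M[R]_n := \matrix_(j, k) \sum_i riemann i i j k p.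

Definition tensor_trace (p : M) (A : 'M[R]_n) : R :=
  \sum_i \sum_j invmx (G p) i j * A i j.

Definition tensor_normsq (p : M) (A : 'M[R]_n) : R :=
  \sum_i \sum_j \sum_k \sum_l
    invmx (G p) i k * invmx (G p) j l * A i j * A k l.

Definition scalar_curv (p : M) : R := tensor_trace p (ricci p).

Definition hessian (f : M -> R) (p : M) : 'M[R]_n :=
  \matrix_(i, j) (pd phi i (pd phi j f) p
                  - \sum_k christoffel k i j p * pd phi k f p).

Definition laplacian (f : M -> R) (p : M) : R := tensor_trace p (hessian f p).

(* nabla f . nabla h *)
Definition grad_dot (f h : M -> R) (p : M) : R :=
  \sum_i \sum_j invmx (G p) i j * pd phi i f p * pd phi j h p.

(* A(nabla f, nabla f) = A_ij f_i f_j, indices contracted with the metric *)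
Definition grad_quad (A : 'M[R]_n) (f : M -> R) (p : M) : R :=
  \sum_i \sum_j \sum_k \sum_l
    invmx (G p) i k * invmx (G p) j l * A i j * pd phi k f p * pd phi l f p.

End Geometry.

Definition ricci_flow (R : realType) (n : nat) (M : topologicalType)
    (X : smooth_manifold R n M) (T : R) (g : metric_family X T) : Prop :=
  forall phi t p, atlas X phi -> t \in `[0, T] -> chart_dom phi p ->
  forall i j : 'I_n,
    ddt T (fun s q => g phi s q i j) t p = - 2 * ricci phi (g phi t) p i j.

(* d/dtau = - d/dt, for tau = T - t *)
Definition ddtau (R : realType) (M : Type) (T : R) (f : R -> M -> R)
    (t : R) (p : M) : R := - ddt T f t p.

(* Main.v *)
Require Import Defs.
From HB Require Import structures.
From mathcomp Require Import all_boot all_order all_algebra.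
From mathcomp Require Import all_classical all_reals all_analysis.
From mathcomp Require Import ring lra.
Import Order.TTheory GRing.Theory Num.Theory.
Import numFieldNormedType.Exports.
Local Open Scope classical_set_scope.
Local Open Scope ring_scope.

(** Every object in the statement is local: in the chart [phi] and for times in
    [0, T[, all of them are built from the components of the metric and from u
    by ring operations, the coordinate derivatives and d/dt.  The functions that
    are smooth in the sense of [time_smooth_on] form a commutative ring
    [smooth_fun], on which these operators are commuting derivations [Dspace]
    and [Dtime].  So the theorem is a statement of differential algebra, and it
    is proved over an arbitrary commutative ring that contains 1/2 and carries
    commuting derivations D_1, ..., D_n and dt, for a symmetric matrix G with
    inverse h such that dt G = - 2 Ric.

    The connection is then a family of matrices conn i = (Gamma^k_ij)_kj, the
    curvature is curv i j = D_i conn j - D_j conn i + [conn i, conn j], and the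
    symmetries of the curvature are matrix identities.  Contracting the second
    Bianchi identity twice gives D_m R = 2 nabla^j R_jm
    ([bianchi_contracted]), and exchanging two covariant derivatives of du gives
    the Bochner formula for Delta |nabla u|^2 ([bochner]).

    The variation C = dt conn of the connection satisfies the Koszul formula
    with - 2 Ric in place of the metric ([lower_dconn]).  Its two traces are
    h^jk C^l_jk = 0, by [bianchi_contracted], and C^i_ik = - D_k R.  They give
      dt Delta f = Delta dt f + 2 <Ric, Hess f>     ([dt_lap]),
      dt R = Delta R + 2 |Ric|^2                    ([dt_scal]),
    to which one adds dt |nabla f|^2 = 2 Ric (nabla f, nabla f)
    + 2 nabla f . nabla dt f ([dt_gdot]).  Substituting these formulas, the
    equation of u and the Bochner formula into dt H gives [H_evolution].  The
    theorem follows by expanding the square ([contr2_shift]) and adding and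
    subtracting the multiple of H.

    On the analytic side, the commutation of the derivations is the equality of
    mixed derivatives.  It is proved for one derivative taken within an interval
    ([mixed_derivative]), since d/dt is one-sided at time 0. *)

Set Implicit Arguments.
Unset Strict Implicit.
Unset Printing Implicit Defensive.

(** * Derivations and tensors over a commutative ring *)

Lemma mxD_entry (A : pzRingType) m n (B C : 'M[A]_(m, n)) i j :
  (B + C) i j = B i j + C i j.
Proof. by rewrite mxE. Qed.
Lemma mxN_entry (A : pzRingType) m n (B : 'M[A]_(m, n)) i j :
  (- B) i j = - B i j.
Proof. by rewrite mxE. Qed.
Lemma trmxD (A : pzRingType) m n (B C : 'M[A]_(m, n)) : (B + C)^T = B^T + C^T.
Proof. exact: raddfD. Qed.
Lemma trmxN (A : pzRingType) m n (B : 'M[A]_(m, n)) : (- B)^T = - B^T.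
Proof. exact: raddfN. Qed.

Record deriv (A : comPzRingType) := Deriv {
  deriv_fun :> A -> A;
  derivD : {morph deriv_fun : x y / x + y};
  derivM : forall x y, deriv_fun (x * y) = deriv_fun x * y + x * deriv_fun y }.

Section Derivation.
Variables (A : comPzRingType) (d : deriv A).

(** Being additive, a derivation inherits the generic theory of additive maps,
    in particular its compatibility with sums and with entrywise application to
    matrices. *)
Fact deriv_zmod_morphism : zmod_morphism d.
Proof.
have d0 : d 0 = 0 by apply: (addIr (d 0)); rewrite -derivD !add0r.
have dN x : d (- x) = - d x by apply: (addIr (d x)); rewrite -derivD !addNr.
by move=> x y; rewrite derivD dN.
Qed.
HB.instance Definition _ :=
  GRing.isZmodMorphism.Build A A d deriv_zmod_morphism.

Lemma derivN x : d (- x) = - d x.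
Proof. exact: raddfN. Qed.

Lemma deriv1 : d 1 = 0.
Proof.
by apply: (addIr (d 1)); rewrite add0r -[in RHS](mulr1 (1 : A)) derivM mulr1
  mul1r.
Qed.

Lemma derivZ c x : d c = 0 -> d (c * x) = c * d x.
Proof. by move=> dc; rewrite derivM dc mul0r add0r. Qed.

Lemma deriv_mulmx m n p (B : 'M[A]_(m, n)) (C : 'M[A]_(n, p)) :
  map_mx d (B *m C) = map_mx d B *m C + B *m map_mx d C.
Proof.
apply/matrixP => i j; rewrite !mxE raddf_sum -big_split /=.
by apply: eq_bigr => k _; rewrite derivM !mxE.
Qed.
End Derivation.

Section Frobenius.
Variables (A : comPzRingType) (n : nat).
Implicit Types (X B C : 'M[A]_n) (v w : 'cV[A]_n).

(** The contraction X^ij B_ij; with X the inverse metric it is the trace of a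
    covariant 2-tensor. Writing all contractions in this form turns index
    manipulations into matrix products moved from one side to the other. *)
Definition frob X B : A := \sum_i \sum_j X i j * B i j.

Lemma frobE X B : frob X B = \tr (X^T *m B).
Proof.
rewrite /frob exchange_big; apply: eq_bigr => j _; rewrite mxE.
by apply: eq_bigr => i _; rewrite mxE.
Qed.

Lemma frobC X B : frob X B = frob B X.
Proof. by apply: eq_bigr => i _; apply: eq_bigr => j _; rewrite mulrC. Qed.

Lemma frob_tr X B : frob X^T B = frob X B^T.
Proof. by rewrite !frobE trmxK -mxtrace_tr trmx_mul mxtrace_mulC. Qed.

Lemma frobDr X B C : frob X (B + C) = frob X B + frob X C.
Proof. by rewrite !frobE mulmxDr mxtraceD. Qed.

Lemma frobNr X B : frob X (- B) = - frob X B.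
Proof. by rewrite !frobE mulmxN raddfN. Qed.

Lemma frobZr c X B : frob X (c *: B) = c * frob X B.
Proof. by rewrite !frobE -scalemxAr mxtraceZ. Qed.

Lemma frobDl X B C : frob (B + C) X = frob B X + frob C X.
Proof. by rewrite frobC frobDr !(frobC X). Qed.

Lemma frobNl X B : frob (- B) X = - frob B X.
Proof. by rewrite frobC frobNr frobC. Qed.

Lemma frobZl c X B : frob (c *: B) X = c * frob B X.
Proof. by rewrite frobC frobZr frobC. Qed.

Lemma frob_mull X B C : frob X (B *m C) = frob (B^T *m X) C.
Proof. by rewrite !frobE trmx_mul trmxK mulmxA. Qed.

Lemma frob_mulr X B C : frob X (B *m C) = frob (X *m C^T) B.
Proof.
by rewrite !frobE trmx_mul trmxK mulmxA -mulmxA mxtrace_mulC -mulmxA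
  mxtrace_mulC.
Qed.

Lemma deriv_frob (d : deriv A) X B :
  d (frob X B) = frob (map_mx d X) B + frob X (map_mx d B).
Proof.
rewrite /frob raddf_sum -big_split; apply: eq_bigr => i _ /=.
rewrite raddf_sum -big_split; apply: eq_bigr => j _ /=.
by rewrite derivM !mxE.
Qed.

(** The inner product of two covariant 2-tensors for the inverse metric h, as
    an index sum in order to match the definitions of the norm and of Ric
    (nabla f, nabla f). *)
Definition contr2 (h B C : 'M[A]_n) : A :=
  \sum_i \sum_j \sum_k \sum_l h i k * h j l * B i j * C k l.

Lemma contr2E h B C : contr2 h B C = frob (h^T *m B *m h) C.
Proof.
rewrite /contr2 /frob.
under eq_bigr => i _ do rewrite exchange_big.
rewrite exchange_big; apply: eq_bigr => k _.
under eq_bigr => i _ do rewrite exchange_big.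
rewrite exchange_big; apply: eq_bigr => l _ /=.
rewrite exchange_big mxE big_distrl; apply: eq_bigr => j _ /=.
rewrite mxE !big_distrl; apply: eq_bigr => i _ /=.
by rewrite mxE; ring.
Qed.
End Frobenius.

(** * Connection and covariant derivatives *)

Section Geometry.
Variables (A : comPzRingType) (n : nat) (D : 'I_n -> deriv A).
Hypothesis DC : forall i j x, D i (D j x) = D j (D i x).
Variable half : A.
Hypothesis half2 : half + half = 1.
Variables G h : 'M[A]_n.
Hypothesis G_sym : G^T = G.
Hypothesis hG : h *m G = 1%:M.

Lemma half_double x : half * (x + x) = x.
Proof. by rewrite mulrDr -mulrDl half2 mul1r. Qed.

Lemma double_inj (x y : A) : x + x = y + y -> x = y.
Proof. by move=> e; rewrite -(half_double x) e half_double. Qed.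

Lemma Gh : G *m h = 1%:M.
Proof. exact: mulmx1C. Qed.

Lemma h_sym : h^T = h.
Proof.
by rewrite -[LHS]mulmx1 -Gh mulmxA -{1}G_sym -trmx_mul Gh trmx1 mul1mx.
Qed.

Lemma G_symE i j : G i j = G j i. Proof. by rewrite -{1}G_sym mxE. Qed.
Lemma h_symE i j : h i j = h j i. Proof. by rewrite -{1}h_sym mxE. Qed.

(** Differentiate h G = 1. *)
Lemma deriv_inv (d : deriv A) : map_mx d h = - (h *m map_mx d G *m h).
Proof.
have : map_mx d (h *m G) = 0.
  rewrite hG; apply/matrixP => i j; rewrite !mxE.
  by case: (i == j); rewrite ?deriv1 ?raddf0.
rewrite deriv_mulmx => /(canRL (addrK _)); rewrite add0r => e.
by rewrite -[LHS]mulmx1 -Gh mulmxA e mulNmx.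
Qed.

Definition gamma (k i j : 'I_n) : A :=
  half * \sum_l h k l * (D i (G j l) + D j (G i l) - D l (G i j)).

(** The matrix of the covariant derivative along the i-th coordinate field,
    acting on the components of vector fields. *)
Definition conn (i : 'I_n) : 'M[A]_n := \matrix_(k, j) gamma k i j.

Lemma gamma_sym k i j : gamma k i j = gamma k j i.
Proof.
congr (_ * _); apply: eq_bigr => l _; rewrite (G_symE i j).
by rewrite (addrC (D i _)).
Qed.

Lemma conn_sym k i j : conn i k j = conn j k i.
Proof. by rewrite !mxE gamma_sym. Qed.

(** Multiplying by G cancels the h in the Christoffel symbols. *)
Lemma lower_conn a i j :
  (G *m conn i) a j = half * (D i (G j a) + D j (G i a) - D a (G i j)).
Proof.
rewrite mxE; under eq_bigr => k _ do
  rewrite mxE /gamma mulrCA mulr_sumr.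
rewrite -mulr_sumr exchange_big; congr (_ * _) => /=.
under eq_bigr => l _ do
  (under eq_bigr => k _ do rewrite mulrA; rewrite -mulr_suml).
have e l : \sum_k G a k * h k l = (a == l)%:R.
  by have := congr1 (fun M : 'M[A]_n => M a l) Gh; rewrite !mxE.
under eq_bigr => l _ do rewrite e.
rewrite (bigD1 a) //= eqxx mul1r big1 ?addr0 // => l /negbTE la.
by rewrite eq_sym la mul0r.
Qed.

(** This says nabla g = 0. *)
Lemma metric_compat i :
  map_mx (D i) G = (conn i)^T *m G + G *m conn i.
Proof.
have -> : (conn i)^T *m G = (G *m conn i)^T by rewrite trmx_mul G_sym.
apply/matrixP => a j; rewrite [LHS]mxE [RHS]mxE [X in X + _]mxE !lower_conn.
rewrite -mulrDr (G_symE i a) (G_symE i j) (G_symE j a).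
by rewrite -[LHS]half_double; congr (_ * _); ring.
Qed.

Lemma deriv_h i : map_mx (D i) h = - (conn i *m h + h *m (conn i)^T).
Proof.
rewrite deriv_inv metric_compat mulmxDr mulmxDl !mulmxA hG mul1mx.
by rewrite -(mulmxA _ G h) Gh mulmx1 addrC.
Qed.

(** Covariant derivatives of a covector, of a covariant 2-tensor ([cov2]) and
    of an endomorphism ([covE]). Only the displayed indices are differentiated
    covariantly; the corrections for further lower indices are added by hand
    where they do not cancel. *)
Definition covV (m : 'I_n) (v : 'cV[A]_n) : 'cV[A]_n :=
  map_mx (D m) v - (conn m)^T *m v.
Definition cov2 (m : 'I_n) (B : 'M[A]_n) : 'M[A]_n :=
  map_mx (D m) B - (conn m)^T *m B - B *m conn m.
Definition covE (m : 'I_n) (E : 'M[A]_n) : 'M[A]_n :=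
  map_mx (D m) E + conn m *m E - E *m conn m.

Lemma cov2_tr m B : (cov2 m B)^T = cov2 m B^T.
Proof.
rewrite /cov2 !linearB /= !trmx_mul trmxK map_trmx -!addrA.
by rewrite (addrC (- (B^T *m _))).
Qed.

(** The trace commutes with covariant differentiation because nabla h = 0. *)
Lemma deriv_trace m B : D m (frob h B) = frob h (cov2 m B).
Proof.
rewrite deriv_frob deriv_h /cov2 !frobDr !frobNr frobNl frobDl.
rewrite frob_mull frob_mulr trmxK; ring.
Qed.

Definition nabla (v : 'cV[A]_n) : 'M[A]_n := \matrix_(i, j) covV i v j 0.

Lemma nablaE v i j : nabla v i j = D i (v j 0) - \sum_k gamma k i j * v k 0.
Proof.
rewrite !mxE; congr (_ - _); apply: eq_bigr => k _.
by rewrite !mxE.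
Qed.

Definition grad (f : A) : 'cV[A]_n := \col_i D i f.
Definition hess (f : A) : 'M[A]_n :=
  \matrix_(i, j) (D i (D j f) - \sum_k gamma k i j * D k f).
Definition lap (f : A) : A := frob h (hess f).
Definition gdot (f k : A) : A := \sum_i \sum_j h i j * D i f * D j k.

Lemma hessE f : hess f = nabla (grad f).
Proof.
apply/matrixP => i j; rewrite nablaE !mxE; congr (_ - _).
by apply: eq_bigr => k _; rewrite !mxE.
Qed.

Lemma hess_sym f : (hess f)^T = hess f.
Proof.
apply/matrixP => i j; rewrite !mxE DC; congr (_ - _).
by apply: eq_bigr => k _; rewrite gamma_sym.
Qed.

Lemma gdotE f k : gdot f k = frob h (grad f *m (grad k)^T).
Proof.
by apply: eq_bigr => i _; apply: eq_bigr => j _;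
  rewrite mxE big_ord1 !mxE mulrA.
Qed.

(** * Curvature and the Bianchi identities *)

Definition curv (i j : 'I_n) : 'M[A]_n :=
  map_mx (D i) (conn j) - map_mx (D j) (conn i)
  + conn i *m conn j - conn j *m conn i.
Definition ric : 'M[A]_n := \matrix_(j, k) \sum_i curv i j i k.
Definition scal : A := frob h ric.

Lemma curv_anti i j : curv j i = - curv i j.
Proof.
by rewrite /curv !opprD !opprK; apply/matrixP => a b; rewrite !mxD_entry; ring.
Qed.

Lemma map_derivC i j m p (B : 'M[A]_(m, p)) :
  map_mx (D i) (map_mx (D j) B) = map_mx (D j) (map_mx (D i) B).
Proof. by apply/matrixP => a b; rewrite !mxE DC. Qed.

(** The Ricci identity: the terms of second order cancel since the derivations
    commute. *)
Lemma covV_comm k j v :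
  covV k (covV j v) - covV j (covV k v) = - ((curv k j)^T *m v).
Proof.
rewrite /covV /curv !(trmxD, trmxN) !map_mxB.
rewrite !deriv_mulmx !trmx_mul !map_trmx (map_derivC k j).
rewrite ?mulmxDl ?mulmxDr ?mulNmx ?mulmxN ?mulmxA.
by apply/matrixP => a b; rewrite !(mxD_entry, mxN_entry); ring.
Qed.

Lemma cov2_nabla k v j m :
  cov2 k (nabla v) j m = covV k (covV j v) m 0
                         - \sum_a gamma a k j * nabla v a m.
Proof.
rewrite /cov2 /covV !(mxD_entry, mxN_entry) !mxE.
rewrite addrAC; congr (_ - _ - _).
  by apply: eq_bigr => a _; rewrite !mxE mulrC.
by apply: eq_bigr => a _; rewrite [(conn k)^T _ _]mxE [conn k _ _]mxE.
Qed.

(** The Ricci identity for the second covariant derivative of a covector. The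
    correction for the lower index of nabla v is symmetric in k and j by
    [gamma_sym], hence it drops out. *)
Lemma cov2_nabla_comm k j m v :
  cov2 k (nabla v) j m = cov2 j (nabla v) k m - \sum_l curv k j l m * v l 0.
Proof.
rewrite !cov2_nabla.
have := congr1 (fun M : 'cV[A]_n => M m 0) (covV_comm k j v).
rewrite !(mxD_entry, mxN_entry) => /(canRL (subrK _)) ->; rewrite [in LHS]mxE.
under [in RHS]eq_bigr => a _ do rewrite gamma_sym.
rewrite (_ : \sum_j0 _ = \sum_l curv k j l m * v l 0); first by ring.
by apply: eq_bigr => l _; rewrite mxE.
Qed.

(** Apply D_i D_j = D_j D_i to the metric and expand with [metric_compat]
    twice: what remains is the action of the curvature on the metric. *)
Lemma curv_lower_anti i j : (G *m curv i j)^T = - (G *m curv i j).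
Proof.
apply/eqP; rewrite -subr_eq0 opprK; apply/eqP.
have := map_derivC i j G; rewrite !metric_compat !map_mxD !deriv_mulmx.
rewrite !metric_compat.
rewrite trmx_mul G_sym /curv !(trmxD, trmxN) !trmx_mul !map_trmx.
rewrite ?mulmxDl ?mulmxDr ?mulNmx ?mulmxN ?mulmxA => e.
apply/matrixP => a b; move/matrixP: e => /(_ a b).
rewrite !(mxD_entry, mxN_entry) => /eqP; rewrite -subr_eq0 => /eqP e.
by rewrite [RHS]mxE -[RHS]e; ring.
Qed.

Lemma curv_raise_anti i j : (curv i j *m h)^T = - (curv i j *m h).
Proof.
have e : curv i j *m h = h *m (G *m curv i j) *m h by rewrite mulmxA hG mul1mx.
by rewrite e trmx_mul (trmx_mul h) h_sym curv_lower_anti mulNmx mulmxN mulmxA.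
Qed.

Lemma tr_curv i j : \tr (curv i j) = 0.
Proof.
apply: double_inj; rewrite addr0.
have -> : curv i j = h *m (G *m curv i j) by rewrite mulmxA hG mul1mx.
rewrite -{1}mxtrace_tr (trmx_mul h) h_sym curv_lower_anti mxtrace_mulC mulmxN.
by rewrite raddfN addNr.
Qed.

Lemma bianchi1 i j k l : curv i j l k + curv j k l i + curv k i l j = 0.
Proof.
have dsym a b c : map_mx (D a) (conn b) l c = map_mx (D a) (conn c) l b.
  by rewrite mxE [RHS]mxE conn_sym.
have qsym a b c : (conn a *m conn b) l c = (conn a *m conn c) l b.
  by rewrite mxE [RHS]mxE; apply: eq_bigr => m _; rewrite (conn_sym m b).
rewrite /curv !(mxD_entry, mxN_entry).
rewrite (dsym i k j) (dsym j k i) (dsym k j i).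
by rewrite (qsym i k j) (qsym j k i) (qsym k j i); ring.
Qed.

(** The first Bianchi identity expresses the antisymmetric part of Ric by the
    trace of the endomorphism curv j k, which vanishes by [tr_curv]. *)
Lemma ric_sym : ric^T = ric.
Proof.
apply/matrixP => j k; rewrite !mxE; apply/esym/eqP.
rewrite -subr_eq0 -sumrB.
have e i : curv i j i k - curv i k i j = - curv j k i i.
  have := bianchi1 i j k i; rewrite (curv_anti i k) !mxN_entry => /eqP.
  by rewrite addrAC addr_eq0 => /eqP.
under eq_bigr => i _ do rewrite e.
by rewrite sumrN -[\sum_i _]/(\tr (curv j k)) tr_curv oppr0.
Qed.

(** With the curvature as a commutator of operators, this is the Jacobi
    identity. The corrections for the indices i and j are not included here:
    they cancel in the cyclic sum (see [bianchi2_cov]). *)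
Lemma bianchi2 m i j :
  covE m (curv i j) + covE i (curv j m) + covE j (curv m i) = 0.
Proof.
rewrite /covE /curv !map_mxB !map_mxD !map_mxN !deriv_mulmx.
rewrite (map_derivC m i) (map_derivC i j) (map_derivC j m).
rewrite ?mulmxDl ?mulmxDr ?mulNmx ?mulmxN ?mulmxDl ?mulmxDr ?mulNmx ?mulmxN
  ?mulmxA.
by apply/matrixP => a b; rewrite !(mxD_entry, mxN_entry) [RHS]mxE; ring.
Qed.

(** The correction term in the covariant derivative of a tensor with values in
    endomorphisms, for the lower index j. *)
Definition gamma_contr (B : 'I_n -> 'M[A]_n) (i j : 'I_n) : 'M[A]_n :=
  \sum_a gamma a i j *: B a.

Definition cov_curv (m i j : 'I_n) : 'M[A]_n :=
  covE m (curv i j) - gamma_contr (curv^~ j) m i - gamma_contr (curv i) m j.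

Lemma gamma_contr_sym B i j : gamma_contr B i j = gamma_contr B j i.
Proof. by apply: eq_bigr => a _; rewrite gamma_sym. Qed.

Lemma bianchi2_cov m i j :
  cov_curv m i j + cov_curv i j m + cov_curv j m i = 0.
Proof.
have e a b c : gamma_contr (curv a) b c = - gamma_contr (curv^~ a) b c.
  by rewrite -sumrN; apply: eq_bigr => l _; rewrite curv_anti scalerN.
rewrite /cov_curv (e i m) (e j i) (e m j) (gamma_contr_sym _ i m)
  (gamma_contr_sym _ j i).
rewrite (gamma_contr_sym _ j m) -[RHS](bianchi2 m i j).
by apply/matrixP => a b; rewrite !(mxD_entry, mxN_entry); ring.
Qed.

Lemma cov_curv_anti m i j : cov_curv m j i = - cov_curv m i j.
Proof.
have e a b c : gamma_contr (curv a) b c = - gamma_contr (curv^~ a) b c.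
  by rewrite -sumrN; apply: eq_bigr => l _; rewrite curv_anti scalerN.
rewrite /cov_curv !e curv_anti /covE map_mxN mulmxN mulNmx.
by apply/matrixP => a b; rewrite !(mxD_entry, mxN_entry); ring.
Qed.

Lemma gamma_contrE B i j l k :
  gamma_contr B i j l k = \sum_a gamma a i j * B a l k.
Proof. by rewrite summxE; apply: eq_bigr => a _; rewrite mxE. Qed.

(** Contracting the upper index with one lower index commutes with covariant
    differentiation: the correction for the upper index cancels the one for
    that lower index. *)
Lemma tr_covE (B : 'I_n -> 'M[A]_n) m j :
  \sum_i (covE m (B i) - gamma_contr B m i) i j =
  (map_mx (D m) (\col_k \sum_i B i i k)
   - (conn m)^T *m \col_k \sum_i B i i k) j 0.
Proof.
have e : \sum_i (conn m *m B i) i j = \sum_i gamma_contr B m i i j.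
  under eq_bigr => i _ do rewrite mxE.
  under [RHS]eq_bigr => i _ do rewrite gamma_contrE.
  rewrite exchange_big; apply: eq_bigr => a _; apply: eq_bigr => i _.
  by rewrite mxE.
under eq_bigr => i _ do rewrite !(mxD_entry, mxN_entry).
rewrite !big_split /= !sumrN e addrAC addrK !(mxD_entry, mxN_entry) !mxE.
rewrite (raddf_sum (D m)) /=; congr (_ - _).
  by apply: eq_bigr => i _; rewrite mxE.
under eq_bigr => i _ do rewrite mxE.
rewrite exchange_big; apply: eq_bigr => a _ /=.
by rewrite -mulr_suml mulrC [(conn m)^T _ _]mxE [in RHS]mxE.
Qed.

Lemma tr_cov_curv m j k : \sum_i cov_curv m i j i k = cov2 m ric j k.
Proof.
under eq_bigr => i _ do rewrite /cov_curv mxD_entry.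
rewrite big_split /= (tr_covE (curv^~ j)) /cov2.
have e : \col_k0 \sum_i curv i j i k0 = col j ric^T.
  by apply/colP => l; rewrite !mxE.
rewrite e !(mxD_entry, mxN_entry) !mxE.
under eq_bigr => i _ do rewrite mxN_entry gamma_contrE.
rewrite sumrN exchange_big /= addrAC; congr (_ - _ - _).
  apply: eq_bigr => a _; rewrite -mulr_sumr.
  by rewrite [(conn m)^T _ _]mxE [conn m _ _]mxE [ric _ _]mxE.
apply: eq_bigr => a _; rewrite [col _ _ _ _]mxE [ric^T _ _]mxE.
by rewrite [(conn m)^T _ _]mxE mulrC.
Qed.

Lemma covE_raise m E :
  covE m E *m h = map_mx (D m) (E *m h) + conn m *m (E *m h)
                  + E *m h *m (conn m)^T.
Proof.
rewrite deriv_mulmx deriv_h /covE !mulmxDl mulNmx mulmxN mulmxDr !mulmxA.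
by apply/matrixP => a b; rewrite !(mxD_entry, mxN_entry); ring.
Qed.

Lemma covE_raise_anti m E : (E *m h)^T = - (E *m h) ->
  (covE m E *m h)^T = - (covE m E *m h).
Proof.
move=> anti; rewrite covE_raise !trmxD map_trmx !(trmx_mul (conn m)).
rewrite (trmx_mul (E *m h)) trmxK anti map_mxN mulNmx mulmxN -!opprD.
by rewrite -addrA addrAC -addrA addrC -!addrA addrCA.
Qed.

(** Raising an index commutes with covariant differentiation, so the
    antisymmetry of the curvature passes to its covariant derivative. *)
Lemma cov_curv_raise_anti m i j :
  (cov_curv m i j *m h)^T = - (cov_curv m i j *m h).
Proof.
have gs (B : 'I_n -> 'M[A]_n) a b :
    (forall l, (B l *m h)^T = - (B l *m h)) ->
    (gamma_contr B a b *m h)^T = - (gamma_contr B a b *m h).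
  move=> anti; rewrite mulmx_suml -sumrN raddf_sum /=.
  by apply: eq_bigr => l _; rewrite -scalemxAl linearZ /= anti scalerN.
have anti := covE_raise_anti m (curv_raise_anti i j).
rewrite /cov_curv; move: (covE _ _) anti => E anti.
rewrite !mulmxDl !mulNmx !(trmxD, trmxN) anti !gs -?opprD // => l.
  exact: curv_raise_anti.
exact: curv_raise_anti.
Qed.

(** The divergence h^jk nabla_j B_km. *)
Definition div2 (B : 'M[A]_n) (m : 'I_n) : A :=
  \sum_j \sum_k h j k * cov2 j B k m.

(** Trace the second Bianchi identity over the upper index and the first lower
    one, then with h. The first term becomes D_m R and the third a divergence
    of Ric. The second one is a divergence of Ric too, once the antisymmetry in
    the last two indices has moved the contraction. *)
Theorem bianchi_contracted m : D m scal = div2 ric m + div2 ric m.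
Proof.
rewrite /scal deriv_trace.
have cov_sym i a b : cov2 i ric a b = cov2 i ric b a.
  by rewrite -[in LHS]ric_sym -cov2_tr mxE.
have e j k : cov2 m ric j k + \sum_i cov_curv i j m i k - cov2 j ric m k = 0.
  rewrite -!tr_cov_curv -sumrN -!big_split /= big1 // => i _.
  have := bianchi2_cov m i j; rewrite (cov_curv_anti j i m).
  move: (cov_curv m i j) (cov_curv i j m) (cov_curv j i m) => X Y Z.
  by move/matrixP/(_ i k); rewrite !(mxD_entry, mxN_entry) mxE.
have {}e j k : cov2 m ric j k =
    cov2 j ric k m - \sum_i cov_curv i j m i k.
  by move: (e j k) => /eqP; rewrite subr_eq0 (cov_sym j k) => /eqP <-;
    rewrite addrK.
(* the second term of the cyclic sum, in which the derivative is along the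
   contracted index *)
have K : \sum_j \sum_k h j k * \sum_i cov_curv i j m i k = - div2 ric m.
  transitivity (\sum_i \sum_j (cov_curv i j m *m h) i j).
    rewrite [RHS]exchange_big; apply: eq_bigr => j _ /=.
    under eq_bigr => k _ do rewrite mulr_sumr.
    rewrite exchange_big; apply: eq_bigr => i _ /=; rewrite mxE.
    by apply: eq_bigr => k _; rewrite h_symE mulrC.
  rewrite -sumrN; apply: eq_bigr => i _.
  (* Exchanging the last two indices turns the trace into the one that defines
     Ric. *)
  transitivity (- \sum_j (cov_curv i j m *m h) j i).
    rewrite -sumrN; apply: eq_bigr => j _.
    have /matrixP/(_ j i) := cov_curv_raise_anti i j m.
    by rewrite [X in X = _]mxE [X in _ = X]mxE.
  congr (- _); under eq_bigr => j _ do rewrite mxE.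
  rewrite exchange_big; apply: eq_bigr => k _ /=.
  by rewrite -mulr_suml tr_cov_curv cov_sym h_symE mulrC.
rewrite -{2}[div2 ric m]opprK -K -sumrB; apply: eq_bigr => j _.
by rewrite -sumrB; apply: eq_bigr => k _; rewrite e mulrBr.
Qed.

(** * The Bochner formula *)

Lemma frob_outer (X : 'M[A]_n) (v w : 'cV[A]_n) :
  frob X (v *m w^T) = \sum_i v i 0 * (X *m w) i 0.
Proof.
apply: eq_bigr => i _; rewrite [in RHS]mxE big_distrr;
  apply: eq_bigr => j _ /=.
by rewrite mxE big_ord1 [w^T _ _]mxE; ring.
Qed.

Lemma cov2_outer m v w :
  cov2 m (v *m w^T) = covV m v *m w^T + v *m (covV m w)^T.
Proof.
rewrite /cov2 /covV deriv_mulmx !(trmxD, trmxN) !trmx_mul trmxK map_trmx.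
rewrite mulmxBl mulmxBr !mulmxA.
by apply/matrixP => a b; rewrite !(mxD_entry, mxN_entry); ring.
Qed.

Lemma covV_mulmx m B v :
  covV m (B *m (h *m v)) = cov2 m B *m (h *m v) + B *m (h *m covV m v).
Proof.
rewrite /cov2 /covV !deriv_mulmx deriv_h.
rewrite ?(mulmxDl, mulmxDr, mulNmx, mulmxN, mulmxA).
by apply/matrixP => a b; rewrite !(mxD_entry, mxN_entry); ring.
Qed.

(** Since nabla h = 0, only the two gradients are differentiated. *)
Lemma deriv_gdot m f k :
  D m (gdot f k) = (hess f *m (h *m grad k)) m 0
                   + (hess k *m (h *m grad f)) m 0.
Proof.
have e a b : frob h (covV m (grad a) *m (grad b)^T)
             = (hess a *m (h *m grad b)) m 0.
  rewrite frob_outer [RHS]mxE; apply: eq_bigr => i _.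
  by rewrite hessE [nabla _ _ _]mxE.
rewrite gdotE deriv_trace cov2_outer frobDr -!e; congr (_ + _).
by rewrite -[in LHS]h_sym frob_tr trmx_mul trmxK.
Qed.

(** The trace of the curvature over the indices 1 and 4 is minus the one over 1
    and 3 that defines Ric, by antisymmetry. *)
Lemma tr_curv_raise j l :
  \sum_k \sum_m h k m * curv k j l m = - (ric *m h) j l.
Proof.
transitivity (\sum_k (curv k j *m h) l k).
  apply: eq_bigr => k _; rewrite mxE; apply: eq_bigr => m _.
  by rewrite h_symE mulrC.
transitivity (- \sum_k (curv k j *m h) k l).
  rewrite -sumrN; apply: eq_bigr => k _.
  have /matrixP/(_ k l) := curv_raise_anti k j.
  by rewrite [X in X = _]mxE [X in _ = X]mxE.
congr (- _); under eq_bigr => k _ do rewrite mxE.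
rewrite exchange_big mxE; apply: eq_bigr => m _ /=.
by rewrite -mulr_suml mxE.
Qed.

Definition gquad (B : 'M[A]_n) (f : A) : A :=
  contr2 h B (grad f *m (grad f)^T).

Lemma gquadE B f :
  gquad B f = \sum_j (h *m grad f) j 0 * (B *m (h *m grad f)) j 0.
Proof.
rewrite /gquad contr2E h_sym -frob_outer trmx_mul h_sym.
by rewrite -[in RHS](mulmxA h) frob_mull [in RHS]mulmxA frob_mulr h_sym.
Qed.

(** The gradient of |nabla f|^2 is twice the Hessian applied to nabla f. Its
    divergence gives the squared norm of the Hessian and h^km nabla_k nabla_m
    nabla_j f, in which moving the index j to the front produces the derivative
    of Delta f and a Ricci term. *)
Theorem bochner f :
  lap (gdot f f)
  = 2 * contr2 h (hess f) (hess f) + 2 * gdot f (lap f) + 2 * gquad ric f.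
Proof.
set v := grad f; set w := h *m v; set U := hess f.
have UT : U^T = U by exact: hess_sym.
have gE : grad (gdot f f) = U *m w + U *m w.
  by apply/colP => m; rewrite [LHS]mxE deriv_gdot mxD_entry.
have covD k x y : covV k (x + y) = covV k x + covV k y.
  rewrite /covV map_mxD mulmxDr.
  by apply/matrixP => a b; rewrite !(mxD_entry, mxN_entry); ring.
have nE : nabla (grad (gdot f f)) =
    \matrix_(k, m) (cov2 k U *m w) m 0 + \matrix_(k, m) (cov2 k U *m w) m 0
    + (U *m h *m U + U *m h *m U).
  apply/matrixP => k m; rewrite [LHS]mxE gE covD covV_mulmx !mxD_entry.
  have -> : (U *m (h *m covV k v)) m 0 = (U *m h *m U) k m.
    rewrite -[U *m h *m U]trmxK [RHS]mxE !trmx_mul h_sym UT mulmxA mulmxA.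
    rewrite [LHS]mxE [RHS]mxE; apply: eq_bigr => a _; congr (_ * _).
    by rewrite -UT [RHS]mxE /U hessE [RHS]mxE.
  by rewrite !mxE; ring.
(* the third derivatives of f, traced over the outer pair of indices *)
have first : frob h (\matrix_(k, m) (cov2 k U *m w) m 0)
    = gdot f (lap f) + gquad ric f.
  have U_sym k m j : cov2 k U m j = cov2 k U j m.
    by rewrite -{1}UT -cov2_tr mxE.
  transitivity (\sum_j w j 0 * (D j (lap f)
      - \sum_l (\sum_k \sum_m h k m * curv k j l m) * v l 0)).
    transitivity (\sum_j w j 0 * frob h (\matrix_(k, m) cov2 k U m j)).
      rewrite /frob; under eq_bigr => k _ do
        (under eq_bigr => m _ do rewrite mxE [X in _ * X]mxE mulr_sumr;
         rewrite exchange_big).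
      rewrite exchange_big; apply: eq_bigr => j _ /=; rewrite mulr_sumr.
      apply: eq_bigr => k _; rewrite mulr_sumr; apply: eq_bigr => m _.
      by rewrite [in RHS]mxE; ring.
    apply: eq_bigr => j _; congr (_ * _).
    have -> : \sum_l (\sum_k \sum_m h k m * curv k j l m) * v l 0
              = \sum_k \sum_m h k m * \sum_l curv k j l m * v l 0.
      under eq_bigr => l _ do rewrite mulr_suml.
      rewrite exchange_big; apply: eq_bigr => k _ /=.
      under eq_bigr => l _ do rewrite mulr_suml.
      rewrite exchange_big; apply: eq_bigr => m _ /=.
      by rewrite mulr_sumr; apply: eq_bigr => l _; rewrite mulrA.
    rewrite /lap deriv_trace -/U -sumrB; apply: eq_bigr => k _.
    rewrite -sumrB; apply: eq_bigr => m _; rewrite mxE U_sym /U hessE.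
    by rewrite cov2_nabla_comm mulrBr.
  under eq_bigr => j _ do rewrite mulrBr.
  rewrite sumrB; congr (_ + _).
    rewrite /gdot exchange_big; apply: eq_bigr => j _ /=.
    rewrite -mulr_suml [w _ _]mxE; congr (_ * _).
    by apply: eq_bigr => i _; rewrite h_symE [v _ _]mxE.
  rewrite gquadE -sumrN; apply: eq_bigr => j _; rewrite -mulrN; congr (_ * _).
  rewrite -sumrN mulmxA [RHS]mxE; apply: eq_bigr => l _.
  by rewrite tr_curv_raise; ring.
rewrite {1}/lap hessE nE !frobDr first contr2E h_sym.
by rewrite frob_mull trmx_mul UT h_sym; ring.
Qed.

(** * Variation under the Ricci flow *)

Section Flow.
Variable dt : deriv A.
Hypothesis dtC : forall i x, dt (D i x) = D i (dt x).
Hypothesis flow : map_mx dt G = - (ric + ric).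

Lemma dt_mapC i m p (B : 'M[A]_(m, p)) :
  map_mx dt (map_mx (D i) B) = map_mx (D i) (map_mx dt B).
Proof. by apply/matrixP => a b; rewrite !mxE dtC. Qed.

(** The inverse metric evolves by dt h = 2 h Ric h. *)
Lemma frob_dt_h B : frob (map_mx dt h) B = 2 * contr2 h ric B.
Proof.
rewrite deriv_inv flow mulmxN mulNmx opprK mulmxDr mulmxDl frobDl contr2E
  h_sym.
by ring.
Qed.

Lemma dt_gdot f : dt (gdot f f) = 2 * gquad ric f + 2 * gdot f (dt f).
Proof.
have e : map_mx dt (grad f) = grad (dt f).
  by apply/colP => i; rewrite !mxE dtC.
rewrite [in LHS]gdotE deriv_frob frob_dt_h; congr (_ + _).
rewrite deriv_mulmx -map_trmx e frobDr !gdotE.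
rewrite -[X in frob X (grad (dt f) *m _)]h_sym frob_tr trmx_mul trmxK.
by ring.
Qed.

(** The variation of the Christoffel symbols, a tensor. *)
Definition dconn i : 'M[A]_n := map_mx dt (conn i).

Lemma dconn_sym k i j : dconn i k j = dconn j k i.
Proof. by rewrite mxE [RHS]mxE conn_sym. Qed.

(** Apply dt to nabla g = 0. *)
Lemma dt_metric_compat i :
  cov2 i (map_mx dt G) = (dconn i)^T *m G + G *m dconn i.
Proof.
rewrite /cov2 /dconn; have := dt_mapC i G.
rewrite metric_compat map_mxD !deriv_mulmx => <-.
rewrite map_trmx.
by apply/matrixP => a b; rewrite !(mxD_entry, mxN_entry); ring.
Qed.

(** As in the Koszul formula, cyclic permutation of [dt_metric_compat] isolates
    the variation of the connection, symmetric in its lower indices. *)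
Lemma lower_dconn i j k :
  (G *m dconn i) k j + (G *m dconn i) k j =
  cov2 i (map_mx dt G) j k + cov2 j (map_mx dt G) i k
  - cov2 k (map_mx dt G) i j.
Proof.
have csym a b c : (G *m dconn a) c b = (G *m dconn b) c a.
  by rewrite mxE [RHS]mxE; apply: eq_bigr => l _; rewrite dconn_sym.
have e a b c : cov2 a (map_mx dt G) b c
               = (G *m dconn a) c b + (G *m dconn a) b c.
  have -> : (G *m dconn a) c b = (G *m dconn a)^T b c by rewrite [RHS]mxE.
  by rewrite dt_metric_compat trmx_mul G_sym mxD_entry.
by rewrite !e (csym k i) (csym k j) (csym j i); ring.
Qed.

Lemma cov2_dt_G i : cov2 i (map_mx dt G) = - (cov2 i ric + cov2 i ric).
Proof.
rewrite flow /cov2 map_mxN map_mxD !mulmxN !mulNmx mulmxDl mulmxDr.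
by apply/matrixP => a b; rewrite !(mxD_entry, mxN_entry); ring.
Qed.

Lemma dt_G_trace i : frob h (cov2 i (map_mx dt G)) = - (D i scal + D i scal).
Proof. by rewrite cov2_dt_G frobNr frobDr -deriv_trace. Qed.

(** The trace of [dt_metric_compat]. *)
Lemma tr_dconn k : \tr (dconn k) = - D k scal.
Proof.
apply: double_inj; rewrite -opprD -dt_G_trace dt_metric_compat frobDr.
have -> : (dconn k)^T *m G = (G *m dconn k)^T by rewrite trmx_mul G_sym.
rewrite -frob_tr h_sym.
by rewrite !frobE h_sym mulmxA hG mul1mx.
Qed.

(** After lowering l, the Koszul formula turns the contraction into the
    divergence of dt G minus half the derivative of its trace; for dt G = - 2
    Ric this is zero by the contracted Bianchi identity. *)
Lemma contr_dconn l : \sum_j \sum_k h j k * dconn j l k = 0.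
Proof.
pose w := \col_l \sum_j \sum_k h j k * dconn j l k.
(* It is enough to show that the lowered vector vanishes. *)
suff Gw : G *m w = 0.
  have := congr1 (fun v : 'cV[A]_n => v l 0) (mul1mx w).
  by rewrite -hG -mulmxA Gw mulmx0 mxE [w _ _]mxE => <-.
apply/colP => m; rewrite [RHS]mxE.
have -> : (G *m w) m 0 = \sum_j \sum_k h j k * (G *m dconn j) m k.
  rewrite mxE; under eq_bigr => a _ do rewrite mxE mulr_sumr.
  rewrite exchange_big; apply: eq_bigr => j _ /=.
  under eq_bigr => a _ do rewrite mulr_sumr.
  rewrite exchange_big; apply: eq_bigr => k _ /=.
  by rewrite mxE mulr_sumr; apply: eq_bigr => a _; ring.
apply: double_inj; rewrite addr0 -big_split /=.
transitivity (\sum_j \sum_k (h j k * cov2 j (map_mx dt G) k m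
   + h j k * cov2 k (map_mx dt G) j m - h j k * cov2 m (map_mx dt G) j k)).
  apply: eq_bigr => j _; rewrite -big_split; apply: eq_bigr => k _ /=.
  by rewrite -mulrDr lower_dconn mulrBr mulrDr.
under eq_bigr => j _ do rewrite sumrB big_split /=.
rewrite sumrB big_split /= -[X in _ - X]/(frob h (cov2 m (map_mx dt G))).
have e : \sum_j \sum_k h j k * cov2 j (map_mx dt G) k m
         = - (div2 ric m + div2 ric m).
  rewrite -big_split -sumrN; apply: eq_bigr => j _.
  rewrite -big_split -sumrN; apply: eq_bigr => k _ /=.
  by rewrite cov2_dt_G !(mxD_entry, mxN_entry); ring.
have e' : \sum_j \sum_k h j k * cov2 k (map_mx dt G) j m
          = - (div2 ric m + div2 ric m).
  rewrite exchange_big -e; apply: eq_bigr => j _; apply: eq_bigr => k _.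
  by rewrite h_symE.
by rewrite e e' dt_G_trace bianchi_contracted; ring.
Qed.

(** The Christoffel symbols contribute nothing to the variation of the
    Laplacian, by [contr_dconn]. *)
Lemma dt_lap f : dt (lap f) = 2 * contr2 h ric (hess f) + lap (dt f).
Proof.
rewrite /lap deriv_frob frob_dt_h; congr (_ + _).
have e : map_mx dt (hess f)
         = hess (dt f) - \matrix_(i, j) \sum_k dconn i k j * D k f.
  apply/matrixP => i j; rewrite !mxD_entry mxN_entry !mxE raddfB /= raddf_sum
    /= !dtC.
  rewrite -addrA -opprD -big_split; congr (_ - _); apply: eq_bigr => k _ /=.
  by rewrite derivM !dtC !mxE addrC.
rewrite e frobDr frobNr [X in _ - X](_ : _ = 0) ?subr0 // /frob.
under eq_bigr => i _ do
  (under eq_bigr => j _ do rewrite mxE mulr_sumr; rewrite exchange_big).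
rewrite exchange_big big1 // => k _ /=.
under eq_bigr => i _ do (under eq_bigr => j _ do rewrite mulrA;
  rewrite -mulr_suml).
by rewrite -mulr_suml contr_dconn mul0r.
Qed.

(** The curvature is quadratic in the connection, so its variation is the
    covariant exterior derivative of the variation of the connection. *)
Lemma dt_curv i j : map_mx dt (curv i j) = covE i (dconn j) - covE j (dconn i).
Proof.
rewrite /curv /covE /dconn !(map_mxD, map_mxN) !deriv_mulmx !dt_mapC.
by apply/matrixP => a b; rewrite !(mxD_entry, mxN_entry); ring.
Qed.

(** Contracting the second lower index with h commutes with covariant
    differentiation, and the contraction vanishes by [contr_dconn]. *)
Lemma div_dconn i l :
  \sum_j ((covE i (dconn j) - gamma_contr dconn i j) *m h) l j = 0.
Proof.
have w0 m : \sum_j (dconn j *m h) m j = 0.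
  rewrite -[RHS](contr_dconn m); apply: eq_bigr => j _; rewrite mxE.
  by apply: eq_bigr => k _; rewrite mulrC h_symE.
have e : \sum_j (dconn j *m h *m (conn i)^T) l j
         = \sum_j (gamma_contr dconn i j *m h) l j.
  under eq_bigr => j _ do rewrite mxE.
  rewrite exchange_big; apply: eq_bigr => a _ /=.
  rewrite /gamma_contr mulmx_suml summxE; apply: eq_bigr => j _.
  by rewrite -scalemxAl [in RHS]mxE [(conn i)^T _ _]mxE [conn i _ _]mxE mulrC.
under eq_bigr => j _ do rewrite mulmxBl covE_raise !mxD_entry mxN_entry.
rewrite sumrB !big_split /= e addrK.
under eq_bigr => j _ do rewrite mxE.
rewrite -(raddf_sum (D i)) /= w0 raddf0 add0r.
under eq_bigr => j _ do rewrite mxE.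
by rewrite exchange_big big1 // => a _; rewrite -mulr_sumr w0 mulr0.
Qed.

(** Contract [dt_curv]: one of the two terms vanishes by [div_dconn], the other
    one is minus the divergence of the covector C^i_ik = - D_k R. *)
Lemma dt_scal : dt scal = 2 * contr2 h ric ric + lap scal.
Proof.
rewrite {1}/scal deriv_frob frob_dt_h; congr (_ + _).
pose X i j := covE i (dconn j) - gamma_contr dconn i j.
have e j k : map_mx dt ric j k = \sum_i X i j i k + hess scal j k.
  have {1}-> : hess scal j k = - \sum_i X j i i k.
    rewrite tr_covE -[X in - X]/(covV j _ k 0) hessE [LHS]mxE.
    have -> : \col_k0 \sum_i dconn i i k0 = - grad scal.
      apply/colP => a; rewrite mxE [RHS]mxE [grad _ _ _]mxE -tr_dconn.
      by apply: eq_bigr => i _; rewrite dconn_sym.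
    by rewrite /covV map_mxN mulmxN -opprD mxN_entry opprK.
  rewrite -sumrB [LHS]mxE [ric _ _]mxE (raddf_sum dt) /=;
    apply: eq_bigr => i _.
  have /matrixP/(_ i k) := dt_curv i j; rewrite [LHS]mxE => ->.
  rewrite /X (gamma_contr_sym _ j i).
  move: (covE _ _) (covE _ _) (gamma_contr _ _ _) => Y Z W.
  by rewrite !(mxD_entry, mxN_entry); ring.
rewrite /lap /frob; under eq_bigr => j _ do
  (under eq_bigr => k _ do rewrite e mulrDr; rewrite big_split).
rewrite big_split -[RHS]add0r; congr (_ + _).
under eq_bigr => j _ do
  (under eq_bigr => k _ do rewrite mulr_sumr; rewrite exchange_big).
rewrite exchange_big big1 // => i _ /=; rewrite -[RHS](div_dconn i i).
apply: eq_bigr => j _; rewrite [RHS]mxE; apply: eq_bigr => k _.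
by rewrite h_symE mulrC.
Qed.

(** * The evolution equation of H over a differential ring *)

Lemma gdotC f k : gdot f k = gdot k f.
Proof.
rewrite /gdot exchange_big; apply: eq_bigr => i _; apply: eq_bigr => j _ /=.
by rewrite h_symE; ring.
Qed.

Lemma gdotDl f1 f2 k : gdot (f1 + f2) k = gdot f1 k + gdot f2 k.
Proof.
rewrite -big_split; apply: eq_bigr => i _; rewrite -big_split.
by apply: eq_bigr => j _ /=; rewrite derivD; ring.
Qed.

Lemma gdotZl z f k : (forall i, D i z = 0) -> gdot (z * f) k = z * gdot f k.
Proof.
move=> z0; rewrite /gdot mulr_sumr; apply: eq_bigr => i _; rewrite mulr_sumr.
by apply: eq_bigr => j _; rewrite derivZ //; ring.
Qed.

Lemma gdot_const z k : (forall i, D i z = 0) -> gdot z k = 0.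
Proof.
move=> z0; rewrite /gdot big1 // => i _; rewrite big1 // => j _.
by rewrite z0; ring.
Qed.

Lemma lapD f1 f2 : lap (f1 + f2) = lap f1 + lap f2.
Proof.
rewrite /lap -frobDr; congr frob; apply/matrixP => i j; rewrite !mxE !derivD.
rewrite addrACA -opprD -big_split; congr (_ - _); apply: eq_bigr => k _ /=.
by rewrite derivD mulrDr.
Qed.

Lemma lapZ z f : (forall i, D i z = 0) -> lap (z * f) = z * lap f.
Proof.
move=> z0; rewrite /lap -frobZr; congr frob; apply/matrixP => i j;
  rewrite !mxE.
rewrite !derivZ // mulrBr mulr_sumr; congr (_ - _).
by apply: eq_bigr => k _; rewrite derivZ //; ring.
Qed.

Lemma lap_const z : (forall i, D i z = 0) -> lap z = 0.
Proof.
move=> z0; rewrite /lap /frob big1 // => i _; rewrite big1 // => j _.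
rewrite mxE z0 raddf0 big1 ?subr0 ?mulr0 // => k _; by rewrite z0 mulr0.
Qed.

(** Parameters of the equation are elements of the ring killed by all
    derivations. *)
Definition constant z := (forall i, D i z = 0) /\ dt z = 0.

(** Here sigma stands for 1/tau and nu for the dimension. The square is not
    completed yet, so that no division is needed. *)
Theorem H_evolution (u c alpha beta a b d sigma nu : A)
  (cst_c : constant c) (cst_alpha : constant alpha) (cst_beta : constant beta)
  (cst_a : constant a) (cst_b : constant b) (cst_d : constant d)
  (cst_nu : constant nu)
  (D_sigma : forall i, D i sigma = 0) (dt_sigma : dt sigma = sigma * sigma)
  (dt_u : dt u = - (lap u - gdot u u - c * scal)) :
  let H := alpha * lap u - beta * gdot u u + a * scal + b * (u * sigma)
           + d * (nu * sigma) in
  - dt H = lap H - 2 * gdot H u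
    - (2 * alpha - 2 * beta) * contr2 h (hess u) (hess u)
    - 2 * alpha * contr2 h ric (hess u)
    - 2 * a * contr2 h ric ric
    - 2 * (alpha - 2 * beta) * gquad ric u
    + 2 * (a + beta * c) * gdot scal u
    - (alpha * c + 2 * a) * lap scal
    + b * gdot u u * sigma - b * c * scal * sigma
    - b * u * sigma ^+ 2 - d * nu * sigma ^+ 2.
Proof.
have lapN f : lap (- f) = - lap f.
  by rewrite -mulN1r lapZ ?mulN1r // => i; rewrite derivN deriv1 oppr0.
have gdotNl f k : gdot (- f) k = - gdot f k.
  by rewrite -mulN1r gdotZl ?mulN1r // => i; rewrite derivN deriv1 oppr0.
have [Dc tc] := cst_c; have [Dal tal] := cst_alpha; have [Dbe tbe] := cst_beta.
have [Da ta] := cst_a; have [Db tb] := cst_b; have [Dd td] := cst_d.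
have [Dnu tnu] := cst_nu.
have D0 i : D i (d * (nu * sigma)) = 0 by rewrite !derivZ // D_sigma !mulr0.
move=> H; rewrite /H !(lapD, gdotDl) (lap_const D0) (gdot_const u D0).
rewrite (mulrC u) !(lapN, gdotNl, lapZ, gdotZl) //.
rewrite !(derivD, derivN, derivM) tal tbe ta tb td tnu dt_lap dt_gdot dt_scal.
rewrite dt_sigma dt_u !(lapD, lapN, lapZ) // bochner (gdotC u (- _)).
rewrite !(gdotDl, gdotNl, gdotZl) // (gdotC u (lap u)).
by ring.
Qed.
End Flow.
End Geometry.

(** Bilinear expansion, using <g, B> = tr B and |g|^2 = n. *)
Lemma contr2_shift (A : comPzRingType) n (G h B C : 'M[A]_n) (k m : A) :
  G^T = G -> h *m G = 1%:M ->
  let S := B + k *: C - m *: G in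
  contr2 h S S = contr2 h B B + k ^+ 2 * contr2 h C C + m ^+ 2 * n%:R
    + 2 * k * contr2 h C B - 2 * m * frob h B - 2 * k * m * frob h C.
Proof.
move=> Gs hG S; have hs := h_sym Gs hG; have Gh := Gh hG.
have fG X : frob (h *m G *m h) X = frob h X by rewrite hG mul1mx.
have fhG X : frob (h *m X *m h) G = frob h X.
  rewrite frobE !trmx_mul hs -!mulmxA hG mulmx1 -mxtrace_tr trmx_mul trmxK hs.
  by rewrite mxtrace_mulC frobE hs.
have swap X Y : frob (h *m X *m h) Y = frob (h *m Y *m h) X.
  by rewrite -{2}hs -frob_mulr frobC frob_mull hs mulmxA.
have hGn : frob h G = n%:R by rewrite frobE hs hG mxtrace1.
rewrite !contr2E hs /S !(mulmxDr, mulmxDl, mulmxN, mulNmx) -!scalemxAr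
  -!scalemxAl.
rewrite !(frobDl, frobDr, frobNl, frobNr, frobZl, frobZr) !fG !fhG hGn.
rewrite (swap B C); ring.
Qed.

(** * Time derivatives *)

Section TimeDerivative.
Variables (R : realType) (M : Type) (T : R).
Implicit Types (f g : R -> M -> R) (t l : R) (p : M).

(** A limit statement in place of the function [ddt], so that the rules below
    give existence and value of the derivative together. *)
Definition is_ddt f t p l : Prop :=
  ddt_quotient f t p @ within `[0, T] t^' --> l.

Lemma time_filter t : t \in `[0, T[ -> ProperFilter (within `[0, T] t^').
Proof.
rewrite in_itv /= => /andP[t0 tT]; apply: Build_ProperFilter_ex => B.
rewrite /within /= => -[e /= e0 eB].
pose s := t + Num.min (e / 2) ((T - t) / 2).
have m0 : 0 < Num.min (e / 2) ((T - t) / 2) by rewrite lt_min; apply/andP; lra.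
have me : Num.min (e / 2) ((T - t) / 2) <= e / 2 by rewrite ge_min lexx.
have mT : Num.min (e / 2) ((T - t) / 2) <= (T - t) / 2.
  by rewrite ge_min lexx orbT.
exists s; apply: eB => /=.
- by rewrite /s opprD addNKr normrN gtr0_norm //; lra.
- by rewrite gt_eqF // /s; lra.
- by rewrite /s in_itv /=; apply/andP; lra.
Qed.

Lemma is_ddt_has f t p l : is_ddt f t p l -> has_ddt T f t p.
Proof. by move=> fl; apply/cvg_ex; exists l. Qed.

Lemma ddtE f t p l : t \in `[0, T[ -> is_ddt f t p l -> ddt T f t p = l.
Proof. by move=> tJ; have := time_filter tJ => FF; apply: cvg_lim. Qed.

(** The times s in the filter of the derivative range over [0, T], but near t <
    T they lie in [0, T[, where the functions are known to be smooth. *)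
Lemma time_near t : t \in `[0, T[ -> \forall s \near (within `[0, T] t^'),
  (s \in `[0, T[) /\ s != t.
Proof.
rewrite in_itv /= => /andP[t0 tT]; rewrite near_withinE.
exists (T - t) => /=; first by rewrite subr_gt0.
move=> s /= st s't; rewrite !in_itv /= => /andP[s0 _].
by rewrite s0 s't; split=> //; move: st; rewrite ltr_norml => /andP[]; lra.
Qed.

Lemma is_ddt_eq f g t p l : t \in `[0, T[ ->
  (forall s, s \in `[0, T[ -> f s p = g s p) ->
  is_ddt f t p l -> is_ddt g t p l.
Proof.
move=> tJ fg; apply: cvg_trans; apply: near_eq_cvg.
near=> s; rewrite /ddt_quotient !fg //.
by have [] : (s \in `[0, T[) /\ s != t by near: s; exact: time_near.
Unshelve. all: by end_near. Qed.

Lemma is_ddt_continuous f t p l : t \in `[0, T[ -> is_ddt f t p l ->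
  f s p @[s --> (within `[0, T] t^')] --> f t p.
Proof.
move=> tJ fl; have FF := time_filter tJ.
have : ddt_quotient f t p s * (s - t) + f t p @[s --> (within `[0, T] t^')]
       --> l * (t - t) + f t p.
  apply: cvgD; last exact: cvg_cst.
  apply: cvgM => //; apply: cvgB; last exact: cvg_cst.
  by apply: cvg_within_filter; apply: cvg_within_filter; exact: cvg_id.
rewrite subrr mulr0 add0r; apply: cvg_trans; apply: near_eq_cvg.
near=> s; rewrite /ddt_quotient divfK ?subrK // subr_eq0.
by have [] : (s \in `[0, T[) /\ s != t by near: s; exact: time_near.
Unshelve. all: by end_near. Qed.

Lemma is_ddt_cst r t p : t \in `[0, T[ -> is_ddt (fun _ _ => r) t p 0.
Proof.
move=> tJ; have FF := time_filter tJ; rewrite /is_ddt.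
rewrite (_ : ddt_quotient _ _ _ = cst 0); first exact: cvg_cst.
by apply/funext => s; rewrite /ddt_quotient subrr mul0r.
Qed.

Lemma is_ddtD f g t p l m : t \in `[0, T[ ->
  is_ddt f t p l -> is_ddt g t p m ->
  is_ddt (fun s q => f s q + g s q) t p (l + m).
Proof.
move=> tJ fl gm; have FF := time_filter tJ.
rewrite /is_ddt (_ : ddt_quotient _ _ _ =
  ddt_quotient f t p \+ ddt_quotient g t p); first exact: cvgD.
by apply/funext => s; rewrite /ddt_quotient /= -mulrDl opprD addrACA.
Qed.

Lemma is_ddtM f g t p l m : t \in `[0, T[ ->
  is_ddt f t p l -> is_ddt g t p m ->
  is_ddt (fun s q => f s q * g s q) t p (l * g t p + f t p * m).
Proof.
move=> tJ fl gm; have FF := time_filter tJ.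
have gc := is_ddt_continuous tJ gm.
rewrite /is_ddt (_ : ddt_quotient _ _ _ =
  fun s => ddt_quotient f t p s * g s p + f t p * ddt_quotient g t p s).
  by apply: cvgD; [exact: cvgM|apply: cvgM => //; exact: cvg_cst].
by apply/funext => s; rewrite /ddt_quotient /=; ring.
Qed.

Lemma is_ddtN f t p l : t \in `[0, T[ -> is_ddt f t p l ->
  is_ddt (fun s q => - f s q) t p (- l).
Proof.
move=> tJ fl; have FF := time_filter tJ.
rewrite /is_ddt (_ : ddt_quotient _ _ _ = \- ddt_quotient f t p).
  exact: cvgN.
by apply/funext => s; rewrite /ddt_quotient /=; ring.
Qed.

Lemma is_ddtV f t p l : t \in `[0, T[ ->
  (forall s, s \in `[0, T[ -> f s p != 0) -> is_ddt f t p l ->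
  is_ddt (fun s q => (f s q)^-1) t p (- l * ((f t p)^-1 * (f t p)^-1)).
Proof.
move=> tJ f0 fl; have FF := time_filter tJ; have fc := is_ddt_continuous tJ fl.
have : - ddt_quotient f t p s * ((f s p)^-1 * (f t p)^-1)
    @[s --> (within `[0, T] t^')] --> - l * ((f t p)^-1 * (f t p)^-1).
  apply: cvgM; first exact: cvgN.
  by apply: cvgM; [apply: cvgV => //; exact: f0|exact: cvg_cst].
apply: cvg_trans; apply: near_eq_cvg; near=> s.
have [sJ st] : (s \in `[0, T[) /\ s != t by near: s; exact: time_near.
rewrite /ddt_quotient; field.
by rewrite !f0 // subr_eq0 st.
Unshelve. all: by end_near. Qed.

Lemma is_ddt_time t p : t \in `[0, T[ -> is_ddt (fun s _ => s) t p 1.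
Proof.
move=> tJ; have FF := time_filter tJ.
apply: (@cvg_trans _ (cst 1 @ within `[0, T] t^')); last exact: cvg_cst.
apply: near_eq_cvg; near=> s.
have [_ st] : (s \in `[0, T[) /\ s != t by near: s; exact: time_near.
by rewrite /ddt_quotient divff ?subr_eq0.
Unshelve. all: by end_near. Qed.
End TimeDerivative.

(** * Coordinate derivatives *)

Section ChartCalculus.
Variables (R : realType) (n : nat) (M : topologicalType) (phi : chart R n M).
Local Notation D := (chart_dom phi).
Implicit Types (f g : M -> R) (p : M) (i : 'I_n).

Lemma chart_invK x : (phi @` D) x ->
  D (chart_inv phi x) /\ phi (chart_inv phi x) = x.
Proof. by case=> q Dq <-; rewrite chart_mapK. Qed.

Lemma chart_near p : D p -> \forall x \near phi p, (phi @` D) x.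
Proof.
by move=> Dp; apply: open_nbhs_nbhs; split; [exact: chart_img_open|exists p].
Qed.

(** The image of a chart is open, so continuity within it is continuity. *)
Lemma chart_inv_cvg p : D p -> chart_inv phi x @[x --> phi p] --> p.
Proof.
move=> Dp; have := @chart_inv_continuous _ _ _ phi.
rewrite continuous_open_subspace; last exact: chart_img_open.
move/(_ (phi p)); rewrite inE => /(_ _).
have ip : (phi @` D) (phi p) by exists p.
by move=> /(_ ip); rewrite /continuous_at chart_mapK.
Qed.

Lemma eq_on_near f g p : D p -> (forall q, D q -> f q = g q) ->
  \forall x \near phi p, (f \o chart_inv phi) x = (g \o chart_inv phi) x.
Proof.
move=> Dp fg; apply: filterS (chart_near Dp) => x /chart_invK[Dx _].
by rewrite /= fg.
Qed.

(** A partial derivative at a point of the chart only depends on the values on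
    the chart domain, which is open. *)
Lemma eq_pd f g i p : D p -> (forall q, D q -> f q = g q) ->
  pd phi i f p = pd phi i g p.
Proof.
move=> Dp fg; rewrite /pd.
case: (eqVneq (delta_mx 0 i : 'rV[R]_n) 0) => [->|e0].
  by rewrite !derive0.
by apply: near_eq_derive => //; exact: eq_on_near.
Qed.

Lemma eq_has_pd f g i p : D p -> (forall q, D q -> f q = g q) ->
  has_pd phi i f p -> has_pd phi i g p.
Proof.
move=> Dp fg; rewrite /has_pd.
case: (eqVneq (delta_mx 0 i : 'rV[R]_n) 0) => [->|e0].
  by move=> _; exact: derivable0.
by apply: near_eq_derivable => //; exact: eq_on_near.
Qed.

Lemma has_pd_cst r i p : has_pd phi i (fun=> r) p /\ pd phi i (fun=> r) p = 0.
Proof. by split; [exact: derivable_cst|exact: derive_cst]. Qed.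

Lemma has_pdD f g i p : has_pd phi i f p -> has_pd phi i g p ->
  has_pd phi i (fun q => f q + g q) p /\
  pd phi i (fun q => f q + g q) p = pd phi i f p + pd phi i g p.
Proof.
by move=> df dg; split; [exact: (derivableD df dg)|exact: (deriveD df dg)].
Qed.

Lemma has_pdN f i p : has_pd phi i f p ->
  has_pd phi i (fun q => - f q) p /\
  pd phi i (fun q => - f q) p = - pd phi i f p.
Proof. by move=> df; split; [exact: (derivableN df)|exact: (deriveN df)]. Qed.

Lemma has_pdM f g i p : D p -> has_pd phi i f p -> has_pd phi i g p ->
  has_pd phi i (fun q => f q * g q) p /\
  pd phi i (fun q => f q * g q) p = pd phi i f p * g p + f p * pd phi i g p.
Proof.
move=> Dp df dg; split; first exact: (derivableM df dg).
rewrite /pd; have := deriveM df dg; rewrite /= chart_mapK // => ->.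
by rewrite addrC [in RHS]mulrC.
Qed.

Lemma has_pdV f i p : D p -> f p != 0 -> has_pd phi i f p ->
  has_pd phi i (fun q => (f q)^-1) p /\
  pd phi i (fun q => (f q)^-1) p = - pd phi i f p * ((f p)^-1 * (f p)^-1).
Proof.
move=> Dp f0 df; have f0' : (f \o chart_inv phi) (phi p) != 0.
  by rewrite /= chart_mapK.
split; first exact: (derivableV f0' df).
rewrite /pd; have := deriveV f0' df; rewrite /= chart_mapK // => ->.
by rewrite /GRing.scale /= -exprVn expr2; ring.
Qed.
End ChartCalculus.

(** * Closure properties of smooth functions *)

Section TimeSmooth.
Variables (R : realType) (n : nat) (M : topologicalType) (phi : chart R n M).
Variable T : R.
Local Notation D := (chart_dom phi).
Local Notation J := (`[0, T[%classic : set R).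
Local Notation dom := [set z : R * M | J z.1 /\ D z.2].
Local Notation Ck := (time_Ck_on phi T J).
Local Notation cont f := {within dom, continuous (fun z : R * M => f z.1 z.2)}.
Implicit Types (f g : R -> M -> R) (k : nat).

Lemma cont_eq f g : (forall t p, J t -> D p -> f t p = g t p) ->
  cont f -> cont g.
Proof.
move=> fg; apply: subspace_eq_continuous => z; rewrite inE => -[Jz Dz].
exact: fg.
Qed.

Lemma contD f g : cont f -> cont g -> cont (fun t p => f t p + g t p).
Proof.
move=> /subspace_continuousP fc /subspace_continuousP gc.
by apply/subspace_continuousP => z dz; exact: cvgD (fc z dz) (gc z dz).
Qed.

Lemma contN f : cont f -> cont (fun t p => - f t p).
Proof.
move=> /subspace_continuousP fc.
by apply/subspace_continuousP => z dz; exact: cvgN (fc z dz).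
Qed.

Lemma contM f g : cont f -> cont g -> cont (fun t p => f t p * g t p).
Proof.
move=> /subspace_continuousP fc /subspace_continuousP gc.
by apply/subspace_continuousP => z dz; exact: cvgM (fc z dz) (gc z dz).
Qed.

Lemma contV f : (forall t p, J t -> D p -> f t p != 0) ->
  cont f -> cont (fun t p => (f t p)^-1).
Proof.
move=> f0 /subspace_continuousP fc.
apply/subspace_continuousP => -[t p] dz.
by apply: cvgV (fc _ dz); case: dz => *; exact: f0.
Qed.

Lemma Ck_cont k f : Ck k f -> cont f.
Proof. by case: k => [[]|k []]. Qed.

Lemma Ck_ddt k f : Ck k.+1 f ->
  (forall t p, J t -> D p -> is_ddt T f t p (ddt T f t p)) /\ Ck k (ddt T f).
Proof. by move=> [_ [[h1 h2] _]]; split. Qed.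

Lemma Ck_pd k f i : Ck k.+1 f ->
  (forall t p, J t -> D p -> has_pd phi i (f t) p) /\
  Ck k (fun t => pd phi i (f t)).
Proof. by move=> [_ [_ h]]; exact: h. Qed.

Lemma Ck_eq k f g : (forall t p, J t -> D p -> f t p = g t p) ->
  Ck k f -> Ck k g.
Proof.
elim: k f g => [|k IH] f g fg fk; first by split=> //;
  exact: cont_eq fg (Ck_cont fk).
split; first exact: cont_eq fg (Ck_cont fk).
have [f1 f2] := Ck_ddt fk.
have e t p : J t -> D p -> is_ddt T g t p (ddt T f t p).
  by move=> Jt Dp; apply: is_ddt_eq (f1 t p Jt Dp) => // s Js; exact: fg.
split.
  split=> [t p Jt Dp|]; first exact: is_ddt_has (e t p Jt Dp).
  by apply: IH f2 => t p Jt Dp; rewrite (ddtE _ (e t p Jt Dp)).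
move=> i; have [f3 f4] := Ck_pd i fk; split.
  by move=> t p Jt Dp; apply: eq_has_pd (f3 t p Jt Dp) => // q Dq; exact: fg.
by apply: IH f4 => t p Jt Dp; apply: eq_pd => // q Dq; exact: fg.
Qed.

(** To bound the order of smoothness it is enough to know functions that agree
    with the derivatives on the domain; this is what makes the inductions below
    go through. *)
Lemma Ck_intro k f (f' : R -> M -> R) (fi : 'I_n -> R -> M -> R) : cont f ->
  (forall t p, J t -> D p -> is_ddt T f t p (f' t p)) -> Ck k f' ->
  (forall i t p, J t -> D p ->
    has_pd phi i (f t) p /\ pd phi i (f t) p = fi i t p) ->
  (forall i, Ck k (fi i)) -> Ck k.+1 f.
Proof.
move=> fc f1 f2 f3 f4; split=> //; split=> [|i]; split.
- by move=> t p Jt Dp; exact: is_ddt_has (f1 t p Jt Dp).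
- by apply: Ck_eq f2 => t p Jt Dp; rewrite (ddtE _ (f1 t p Jt Dp)).
- by move=> t p Jt Dp; exact: (f3 i t p Jt Dp).1.
- by apply: Ck_eq (f4 i) => t p Jt Dp; rewrite (f3 i t p Jt Dp).2.
Qed.

Lemma Ck_le k f : Ck k.+1 f -> Ck k f.
Proof.
elim: k f => [|k IH] f fk; first by split=> //; exact: Ck_cont fk.
have [f1 f2] := Ck_ddt fk.
apply: Ck_intro (Ck_cont fk) f1 (IH _ f2) _ (fun i => IH _ (Ck_pd i fk).2).
by move=> i t p Jt Dp; split=> //; exact: (Ck_pd i fk).1.
Qed.

Lemma Ck_cst k r : Ck k (fun _ _ => r).
Proof.
elim: k r => [|k IH] r.
  by split=> //; apply/subspace_continuousP => z _; exact: cvg_cst.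
apply: (@Ck_intro _ _ (fun _ _ => 0) (fun _ _ _ => 0)) => //.
- exact: Ck_cont (IH r).
- by move=> t p Jt Dp; exact: is_ddt_cst.
- by move=> i t p Jt Dp; exact: has_pd_cst.
Qed.

Lemma CkD k f g : Ck k f -> Ck k g -> Ck k (fun t p => f t p + g t p).
Proof.
elim: k f g => [|k IH] f g fk gk.
  by split=> //; exact: contD (Ck_cont fk) (Ck_cont gk).
have [f1 f2] := Ck_ddt fk; have [g1 g2] := Ck_ddt gk.
apply: (Ck_intro _ _ (IH _ _ f2 g2) _
                 (fun i => IH _ _ (Ck_pd i fk).2 (Ck_pd i gk).2)).
- exact: contD (Ck_cont fk) (Ck_cont gk).
- by move=> t p Jt Dp; apply: is_ddtD; [|exact: f1|exact: g1].
- by move=> i t p Jt Dp; apply: has_pdD;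
    [exact: (Ck_pd i fk).1|exact: (Ck_pd i gk).1].
Qed.

Lemma CkN k f : Ck k f -> Ck k (fun t p => - f t p).
Proof.
elim: k f => [|k IH] f fk; first by split=> //; exact: contN (Ck_cont fk).
have [f1 f2] := Ck_ddt fk.
apply: (Ck_intro _ _ (IH _ f2) _ (fun i => IH _ (Ck_pd i fk).2)).
- exact: contN (Ck_cont fk).
- by move=> t p Jt Dp; apply: is_ddtN; [|exact: f1].
- by move=> i t p Jt Dp; apply: has_pdN; exact: (Ck_pd i fk).1.
Qed.

(** The order k + 1 is reduced to the order k by the product rule, whose terms
    involve the factors themselves at order k. *)
Lemma CkM k f g : Ck k f -> Ck k g -> Ck k (fun t p => f t p * g t p).
Proof.
elim: k f g => [|k IH] f g fk gk.
  by split=> //; exact: contM (Ck_cont fk) (Ck_cont gk).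
have [f1 f2] := Ck_ddt fk; have [g1 g2] := Ck_ddt gk.
apply: (Ck_intro _ _ (CkD (IH _ _ f2 (Ck_le gk)) (IH _ _ (Ck_le fk) g2)) _
         (fun i => CkD (IH _ _ (Ck_pd i fk).2 (Ck_le gk))
                       (IH _ _ (Ck_le fk) (Ck_pd i gk).2))).
- exact: contM (Ck_cont fk) (Ck_cont gk).
- by move=> t p Jt Dp; apply: is_ddtM; [|exact: f1|exact: g1].
- by move=> i t p Jt Dp; apply: has_pdM => //;
    [exact: (Ck_pd i fk).1|exact: (Ck_pd i gk).1].
Qed.

(** The derivative of 1/f is minus the derivative of f times (1/f) (1/f), which
    is of class C^k by induction and [CkM]. *)
Lemma CkV k f : (forall t p, J t -> D p -> f t p != 0) ->
  Ck k f -> Ck k (fun t p => (f t p)^-1).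
Proof.
move=> f0; elim: k => [|k IH] fk.
  by split=> //; exact: contV (Ck_cont fk).
have [f1 f2] := Ck_ddt fk; have f2V := IH (Ck_le fk).
apply: (Ck_intro _ _ (CkM (CkN f2) (CkM f2V f2V)) _
         (fun i => CkM (CkN (Ck_pd i fk).2) (CkM f2V f2V))).
- exact: contV (Ck_cont fk).
- move=> t p Jt Dp; apply: is_ddtV => //; last exact: f1.
  by move=> s Js; exact: f0.
- by move=> i t p Jt Dp; apply: has_pdV; [|exact: f0|exact: (Ck_pd i fk).1].
Qed.

Lemma Ck_time k : Ck k (fun t _ => t).
Proof.
have c : cont (fun t (_ : M) => t).
  apply/subspace_continuousP => z _; apply: cvg_within_filter; exact: cvg_fst.
case: k => [|k]; first by split.
apply: (Ck_intro c _ (Ck_cst k 1) _ (fun i => Ck_cst k 0)).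
  by move=> t p Jt Dp; exact: is_ddt_time.
by move=> i t p Jt Dp; exact: has_pd_cst.
Qed.
End TimeSmooth.

(** The metric is smooth up to the time T but u only before it, so everything
    is restricted to [0, T[. *)
Lemma time_Ck_restrict (R : realType) n M (phi : chart R n M) T k f :
  time_Ck_on phi T `[0, T] k f -> time_Ck_on phi T `[0, T[ k f.
Proof.
have sub : `[0, T[%classic `<=` (`[0, T]%classic : set R).
  by move=> s /=; rewrite !in_itv /= => /andP[-> /ltW].
elim: k f => [|k IH] f [fc fr]; split.
- by apply: continuous_subspaceW fc => -[s q] [/= /sub].
- by [].
- by apply: continuous_subspaceW fc => -[s q] [/= /sub].
have [[f1 f2] f3] := fr; split.
  by split; [move=> s q /sub; exact: f1|exact: IH].
move=> i; have [f4 f5] := f3 i.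
by split; [move=> s q /sub; exact: f4|exact: IH].
Qed.

(** * Equality of mixed derivatives *)

Section Schwarz.
Variable R : realType.
Implicit Types (S : set R) (f : R -> R).

(** The derivative of f at s within S. With S = setT it is the usual derivative
    and with S = [0, T] the one of [ddt]. *)
Definition dwithin S f (s l : R) : Prop :=
  (f r - f s) / (r - s) @[r --> within S s^'] --> l.

Lemma dwithinP S f s l : dwithin S f s l <->
  forall e, 0 < e -> exists2 d, 0 < d &
    forall r, S r -> r != s -> `|r - s| < d ->
      `|(f r - f s) / (r - s) - l| < e.
Proof.
split=> [/cvgrPdist_lt h e e0|h].
  have := h e e0; rewrite near_withinE => -[d /= d0 dh];
    exists d => // r Sr rs rd.
  by rewrite distrC; apply: dh => //=; rewrite distrC.
apply/cvgrPdist_lt => e e0; have [d d0 dh] := h e e0.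
rewrite near_withinE; exists d => //= r /= rd rs Sr.
by rewrite distrC; apply: dh => //; rewrite distrC.
Qed.

Lemma dwithin_near S f s l : dwithin S f s l ->
  forall e, 0 < e -> exists2 d, 0 < d &
    forall r, S r -> `|r - s| < d -> `|f r - f s| < e.
Proof.
move=> /dwithinP/(_ 1 ltr01)[d d0 dh] e e0.
have l0 : 0 < `|l| + 1 by rewrite ltr_wpDl.
exists (Num.min d (e / (`|l| + 1))); first by rewrite lt_min d0 divr_gt0.
move=> r Sr; rewrite lt_min => /andP[rd re].
have [->|rs] := eqVneq r s; first by rewrite subrr normr0.
have := dh r Sr rs rd; set q := _ / _ => ql.
have -> : f r - f s = q * (r - s) by rewrite /q divfK // subr_eq0.
have ql' : `|q| < `|l| + 1.
  have : `|q| <= `|q - l| + `|l| by rewrite -{1}[q](subrK l); exact: ler_normD.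
  by lra.
rewrite normrM; apply: le_lt_trans (_ : (`|l| + 1) * `|r - s| < _).
  by apply: ler_wpM2r => //; exact: ltW.
by rewrite mulrC -ltr_pdivlMr.
Qed.

Lemma dwithinB S f g s l m :
  dwithin S f s l -> dwithin S g s m ->
  dwithin S (fun x => f x - g x) s (l - m).
Proof.
move=> fl gm; rewrite /dwithin.
rewrite (_ : (fun r => _) =
  fun r => (f r - f s) / (r - s) - (g r - g s) / (r - s)).
  exact: cvgB.
by apply/funext => r; rewrite -mulrBl; congr (_ / _); ring.
Qed.

Lemma dwithin_is_derive S f s l e : 0 < e ->
  (forall r, `|r - s| < e -> S r) -> dwithin S f s l -> is_derive s 1 f l.
Proof.
move=> e0 eS fl.
have lim : h^-1 *: ((f \o shift s) (h *: 1) - f s) @[h --> 0^'] --> l.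
  apply/cvgrPdist_lt => x x0; have [d d0 dh] := (dwithinP _ _ _ _).1 fl x x0.
  exists (Num.min d e) => /=; first by rewrite lt_min d0.
  move=> h /=; rewrite sub0r normrN lt_min => /andP[hd he] h0.
  have hs : h + s - s = h by rewrite addrK.
  rewrite distrC /= /shift /= /GRing.scale /= mulr1 mulrC -{2}hs.
  by apply: dh; rewrite ?hs //; [apply: eS; rewrite hs|rewrite -subr_eq0 hs].
by apply: DeriveDef; [apply/cvg_ex; exists l|exact: cvg_lim lim].
Qed.

(** At interior points the derivative within S is the usual one, and at the end
    points it still yields continuity. *)
Lemma dwithin_MVT S f f' a b : a < b ->
  (forall x, a <= x <= b -> S x /\ dwithin S f x (f' x)) ->
  exists2 c, a <= c <= b & f b - f a = f' c * (b - a).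
Proof.
move=> ab h; have [] := @MVT _ f f' a b ab.
- move=> x; rewrite in_itv /= => /andP[ax xb].
  have [|_ fx] := h x; first by rewrite !ltW.
  apply: (@dwithin_is_derive S _ _ _ (Num.min (x - a) (b - x))) fx.
    by rewrite lt_min !subr_gt0 ax.
  move=> r; rewrite lt_min !ltr_norml => /andP[/andP[r1 r2] /andP[r3 r4]].
  by apply: (h r _).1; apply/andP; lra.
- apply/subspace_continuousP => x; rewrite /= in_itv /= => xab.
  have [_ fx] := h x xab; apply/cvgrPdist_lt => e e0.
  have [d d0 dh] := dwithin_near fx e0.
  rewrite near_withinE; exists d => //= r /= rd; rewrite in_itv /= => rab.
  by rewrite distrC; apply: dh; [exact: (h r rab).1|rewrite distrC].
move=> c; rewrite in_itv /= => /andP[ac cb] e; exists c => //.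
by rewrite !ltW.
Qed.

Lemma dwithin_MVT_sym S f f' a b : a != b ->
  (forall x, `|x - a| <= `|b - a| -> `|x - b| <= `|b - a| ->
     S x /\ dwithin S f x (f' x)) ->
  exists c, [/\ `|c - a| <= `|b - a|, `|c - b| <= `|b - a|
              & f b - f a = f' c * (b - a)].
Proof.
move=> ab h.
have itv (u v x : R) : u <= x <= v -> `|x - u| <= v - u /\ `|x - v| <= v - u.
  by move=> /andP[ux xv]; rewrite !ler_norml; split; apply/andP; lra.
have [lt|lt|/eqP] := ltgtP a b; last by rewrite (negbTE ab).
- have nba : `|b - a| = b - a by rewrite gtr0_norm ?subr_gt0.
  rewrite nba in h *; have [|c cab e] := @dwithin_MVT S f f' a b lt.
    by move=> x /itv[]; exact: h.
  by have [] := itv _ _ _ cab; exists c.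
- have nba : `|b - a| = a - b by rewrite distrC gtr0_norm ?subr_gt0.
  rewrite nba in h *; have [|c cab e] := @dwithin_MVT S f f' b a lt.
    by move=> x /itv[xb xa]; exact: h.
  by have [] := itv _ _ _ cab; exists c; split=> //; lra.
Qed.

(** If F has an r-derivative Fr, which has a jointly continuous s-derivative
    Frs, then the s-derivative Fs of F is r-differentiable with derivative Frs.
    Two applications of the mean value theorem write the double difference
    quotient of F as a value of Frs at a nearby point. Let first s tend to s0
    and then r to r0. The variable s is restricted to S and may sit on its
    boundary. *)
Lemma mixed_derivative S (F Fr Frs : R -> R -> R) (Fs : R -> R) s0 r0 e0 :
  ProperFilter (within S s0^') -> S s0 ->
  (forall a b x, S a -> S b ->
     `|x - a| <= `|b - a| -> `|x - b| <= `|b - a| -> S x) ->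
  0 < e0 ->
  (forall s r, S s -> `|s - s0| < e0 -> `|r - r0| < e0 ->
     dwithin setT (F s) r (Fr s r)) ->
  (forall s r, S s -> `|s - s0| < e0 -> `|r - r0| < e0 ->
     dwithin S (Fr^~ r) s (Frs s r)) ->
  (forall r, `|r - r0| < e0 -> dwithin S (F^~ r) s0 (Fs r)) ->
  (forall e, 0 < e -> exists2 d, 0 < d & forall s r, S s ->
     `|s - s0| < d -> `|r - r0| < d -> `|Frs s r - Frs s0 r0| < e) ->
  dwithin setT Fs r0 (Frs s0 r0).
Proof.
move=> FF Ss0 convS e00 hFr hFrs hFs hc; apply/dwithinP => e ep.
have [d0 d0p hd] := hc (e / 2) ltac:(lra).
exists (Num.min d0 e0); first by rewrite lt_min d0p.
move=> r _ rr0; rewrite lt_min => /andP[rd re].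
have r0e : `|r0 - r0| < e0 by rewrite subrr normr0.
(* The double difference quotient tends to the difference quotient of Fs as s
   tends to s0, and is close to Frs s0 r0 before the limit. *)
pose Q s :=
  ((F s r - F s0 r) / (s - s0) - (F s r0 - F s0 r0) / (s - s0)) / (r - r0).
have Qlim : Q s @[s --> within S s0^'] --> (Fs r - Fs r0) / (r - r0).
  by apply: cvgM; [apply: cvgB; exact: hFs|exact: cvg_cst].
suff : `|(Fs r - Fs r0) / (r - r0) - Frs s0 r0| <= e / 2 by lra.
have nlim : `|Q s - Frs s0 r0| @[s --> within S s0^'] -->
    `|(Fs r - Fs r0) / (r - r0) - Frs s0 r0|.
  by apply: cvg_norm; apply: cvgB => //; exact: cvg_cst.
rewrite -(cvg_lim _ nlim) //; apply: limr_le.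
  by apply/cvg_ex; eexists; exact: nlim.
rewrite near_withinE; exists (Num.min d0 e0) => /=;
  first by rewrite lt_min d0p.
move=> s /=; rewrite distrC lt_min => /andP[sd se] ss0 Ss.
have s0e : `|s0 - s0| < e0 by rewrite subrr normr0.
have [] := @dwithin_MVT_sym setT (fun r => F s r - F s0 r)
  (fun r => Fr s r - Fr s0 r) r0 r; first by rewrite eq_sym.
  move=> x xr _; split=> //; have xe := le_lt_trans xr re.
  by apply: dwithinB; exact: hFr.
move=> r' [r'r _ er].
have r'e := le_lt_trans r'r re.
have [] := @dwithin_MVT_sym S (Fr^~ r') (Frs^~ r') s0 s;
  first by rewrite eq_sym.
  move=> x xs xs'; have Sx := convS _ _ _ Ss0 Ss xs xs'; split=> //.
  by apply: hFrs => //; exact: le_lt_trans xs se.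
move=> s' [s's s's' es].
have -> : Q s = Frs s' r'.
  have -> : Q s =
      ((F s r - F s0 r) - (F s r0 - F s0 r0)) / (s - s0) / (r - r0).
    by rewrite /Q -mulrBl.
  by rewrite er es; field; rewrite !subr_eq0 ss0 rr0.
apply/ltW/hd; first exact: convS Ss0 Ss s's s's'.
  exact: le_lt_trans s's sd.
exact: le_lt_trans r'r rd.
Qed.
End Schwarz.

Section ChartSchwarz.
Variables (R : realType) (n : nat) (M : topologicalType) (phi : chart R n M).
Variable T : R.
Local Notation D := (chart_dom phi).
Local Notation J := (`[0, T[%classic : set R).
Local Notation dom := [set z : R * M | J z.1 /\ D z.2].
Local Notation Ck := (time_Ck_on phi T J).
Local Notation cont f := {within dom, continuous (fun z : R * M => f z.1 z.2)}.
Local Notation e_ i := (delta_mx 0 i : 'rV[R]_n).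

Lemma line_dwithin (f : 'rV[R]_n -> R) x v r : derivable f (x + r *: v) v ->
  dwithin setT (fun s => f (x + s *: v)) r ('D_v f (x + r *: v)).
Proof.
move=> /cvg_ex[l fl].
have -> : 'D_v f (x + r *: v) = l by exact: cvg_lim fl.
apply/dwithinP => e e0; move/cvgrPdist_lt: fl => /(_ e e0)[d /= d0 dh].
exists d => // s _ sr sd.
have := dh (s - r); rewrite /= sub0r normrN subr_eq0 => /(_ sd sr).
rewrite distrC /shift /= addrCA -scalerDl subrK /GRing.scale /=.
by rewrite [(s - r)^-1 * _]mulrC.
Qed.

Lemma dnbhs_withinT (s : R) : within setT s^' = s^'.
Proof.
apply/funext => B; apply/propext.
by split=> -[e /= e0 eB]; exists e => //= x xe xs; [exact: eB|move=> _;
  exact: eB].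
Qed.

Lemma dwithinT_unique f s (l m : R) :
  dwithin setT f s l -> dwithin setT f s m -> l = m.
Proof.
rewrite /dwithin dnbhs_withinT.
by move=> fl fm; rewrite -(cvg_lim _ fl) // -(cvg_lim _ fm).
Qed.

Lemma chart_ball p : D p -> exists2 d : R, 0 < d &
  forall x, `|x - phi p| < d -> (phi @` D) x.
Proof.
move=> Dp; have [d /= d0 dh] := (nbhs_ballP _ _).1 (chart_near Dp).
by exists d => // x xd; apply: dh; rewrite -ball_normE /= distrC.
Qed.

(** Joint continuity on the manifold, read in the chart. *)
Lemma cont_near (f : R -> M -> R) t p : cont f -> J t -> D p ->
  forall e, 0 < e -> exists2 d : R, 0 < d &
  forall s (x : 'rV[R]_n), J s -> `|s - t| < d -> `|x - phi p| < d ->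
    `|f s (chart_inv phi x) - f t p| < e.
Proof.
move=> /subspace_continuousP fc Jt Dp e e0.
have := fc (t, p) (conj Jt Dp) => /cvgrPdist_lt/(_ e e0).
rewrite near_withinE /= => -[[A B] /= [At Bp] AB].
have [d1 /= d10 dA] := (nbhs_ballP _ _).1 At.
have [d2 /= d20 dB] := (nbhs_ballP _ _).1 (chart_inv_cvg Dp Bp).
have [d3 d30 dD] := chart_ball Dp.
exists (Num.min d1 (Num.min d2 d3)); first by rewrite !lt_min d10 d20.
move=> s x Js; rewrite !lt_min => /andP[s1 _] /andP[_ /andP[x2 x3]].
rewrite distrC; apply: (AB (s, chart_inv phi x)) => /=.
  split; first by apply: dA; rewrite -ball_normE /= distrC.
  by apply: dB; rewrite -ball_normE /= distrC.
by split=> //; exact: (chart_invK (dD x x3)).1.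
Qed.

Lemma pd_dwithin f i x r : (phi @` D) (x + r *: e_ i) ->
  has_pd phi i f (chart_inv phi (x + r *: e_ i)) ->
  dwithin setT (fun s => f (chart_inv phi (x + s *: e_ i))) r
    (pd phi i f (chart_inv phi (x + r *: e_ i))).
Proof.
move=> /chart_invK[Dx xK]; rewrite /has_pd /pd xK => fx.
exact: (line_dwithin fx).
Qed.

(** Time is the variable s of [mixed_derivative], with S = [0, T]: at t = 0
    there are no earlier times. *)
Lemma ddt_pdC f i t p : Ck 2 f -> J t -> D p ->
  ddt T (fun s => pd phi i (f s)) t p = pd phi i (ddt T f t) p.
Proof.
move=> fk Jt Dp; have := Jt; rewrite /= in_itv /= => /andP[t0 tT].
have [f1 f2] := Ck_ddt fk; have [f3 f4] := Ck_pd i fk.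
have [f5 f6] := Ck_pd i f2; have [f7 f8] := Ck_ddt f4.
have [d d0 dD] := chart_ball Dp.
have eN0 : 0 < `|e_ i| + 1 by rewrite ltr_wpDl.
have small (e r : R) : `|r - 0| < e / (`|e_ i| + 1) ->
    `|phi p + r *: e_ i - phi p| < e.
  rewrite subr0 addrAC subrr add0r normrZ ltr_pdivlMr // => h.
  by apply: le_lt_trans h; apply: ler_wpM2l => //; rewrite lerDl.
pose F s r := f s (chart_inv phi (phi p + r *: e_ i)).
pose Fr s r := pd phi i (f s) (chart_inv phi (phi p + r *: e_ i)).
pose Frs s r :=
  ddt T (fun s => pd phi i (f s)) s (chart_inv phi (phi p + r *: e_ i)).
pose Fs r := ddt T f t (chart_inv phi (phi p + r *: e_ i)).
(* The bound d / (|e_i| + 1) keeps the point in the chart, and T - t keeps the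
   time in [0, T[. *)
pose e0 := Num.min (d / (`|e_ i| + 1)) (T - t).
have e00 : 0 < e0 by rewrite lt_min divr_gt0 // subr_gt0.
have inJ s : s \in `[0, T] -> `|s - t| < e0 -> J s.
  rewrite /= !in_itv /= lt_min => /andP[s0 _] /andP[_]; rewrite ltr_norml s0.
  by move=> /andP[_]; lra.
have inO r : `|r - 0| < e0 -> (phi @` D) (phi p + r *: e_ i).
  by rewrite lt_min => /andP[rd _]; apply: dD; exact: small.
have inD r : `|r - 0| < e0 -> D (chart_inv phi (phi p + r *: e_ i)).
  by move=> /inO/chart_invK[].
have p0 : chart_inv phi (phi p + 0 *: e_ i) = p.
  by rewrite scale0r addr0 chart_mapK.
have mixed : dwithin setT Fs 0 (Frs t 0).
  apply: (@mixed_derivative _ `[0, T]%classic F Fr Frs Fs t 0 e0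
            (time_filter Jt)) => //.
  - by rewrite /= in_itv /= t0 ltW.
  - move=> x y z /=; rewrite !in_itv /= => /andP[x0 xT] /andP[y0 yT].
    rewrite !ler_norml => /andP[z1 z2] /andP[z3 z4].
    case: (lerP 0 (y - x)) => yx; [rewrite ger0_norm // in z1 z2 z3 z4|
                                    rewrite ltr0_norm // in z1 z2 z3 z4];
    by apply/andP; lra.
  - move=> s r sI st /inO rO; apply: pd_dwithin => //; apply: f3;
      first exact: inJ.
    exact: (chart_invK rO).1.
  - by move=> s r sI st rr; apply: f7; [exact: inJ|exact: inD].
  - by move=> r rr; apply: f1 => //; exact: inD.
  - move=> e ep; have [d' d'0 dh] := cont_near (Ck_cont f8) Jt Dp ep.
    exists (Num.min e0 (Num.min d' (d' / (`|e_ i| + 1)))).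
      by rewrite lt_min e00 lt_min d'0 divr_gt0.
    move=> s r sI; rewrite lt_min => /andP[se]; rewrite lt_min => /andP[sd _].
    rewrite lt_min => /andP[_]; rewrite lt_min => /andP[_ rd].
    by rewrite /Frs p0; apply: dh => //; [exact: inJ|exact: small].
have Dp0 : (phi @` D) (phi p + 0 *: e_ i) by apply: inO; rewrite subrr normr0.
have := pd_dwithin Dp0; rewrite p0 => /(_ _ (f5 t p Jt Dp)).
by move/(dwithinT_unique mixed); rewrite /Frs p0.
Qed.

Lemma pd_pdC f i j t p : Ck 2 f -> J t -> D p ->
  pd phi j (pd phi i (f t)) p = pd phi i (pd phi j (f t)) p.
Proof.
move=> fk Jt Dp.
have [f1 f2] := Ck_pd j fk; have [f3 f4] := Ck_pd i fk.
have [f5 f6] := Ck_pd i f2; have [f7 f8] := Ck_pd j f4.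
have [d d0 dD] := chart_ball Dp.
(* A displacement s e_j + r e_i with |s|, |r| < e / c has norm less than e. *)
pose c : R := `|e_ i| + `|e_ j| + 1.
have c0 : 0 < c by rewrite ltr_wpDl // addr_ge0.
have small (e s r : R) : `|s - 0| < e / c -> `|r - 0| < e / c ->
    `|phi p + s *: e_ j + r *: e_ i - phi p| < e.
  rewrite !subr0 -(addrA (phi p)) addrAC subrr add0r => hs hr.
  apply: le_lt_trans (ler_normD _ _) _; rewrite !normrZ.
  have e0 : 0 < e.
    by move: (le_lt_trans (normr_ge0 _) hs); rewrite pmulr_lgt0 ?invr_gt0.
  have hs' : `|s| * `|e_ j| <= e / c * `|e_ j|.
    by apply: ler_wpM2r => //; exact: ltW.
  have hr' : `|r| * `|e_ i| <= e / c * `|e_ i|.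
    by apply: ler_wpM2r => //; exact: ltW.
  apply: le_lt_trans (lerD hs' hr') _; rewrite -mulrDr -mulrA.
  rewrite -[ltRHS]mulr1 ltr_pM2l // mulrC ltr_pdivrMr // mul1r /c.
  by rewrite [ltLHS]addrC ltrDl.
pose P s r := chart_inv phi (phi p + s *: e_ j + r *: e_ i).
pose F s r := f t (P s r).
pose Fr s r := pd phi i (f t) (P s r).
pose Frs s r := pd phi j (pd phi i (f t)) (P s r).
pose Fs r := pd phi j (f t) (P 0 r).
pose e0 := d / c; have e00 : 0 < e0 by rewrite divr_gt0.
have inO s r : `|s - 0| < e0 -> `|r - 0| < e0 ->
    (phi @` D) (phi p + s *: e_ j + r *: e_ i).
  by move=> sd rd; apply: dD; exact: small.
have inD s r : `|s - 0| < e0 -> `|r - 0| < e0 -> D (P s r).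
  by move=> sd rd; have [] := chart_invK (inO s r sd rd).
have z0 : `|0 - 0 : R| < e0 by rewrite subrr normr0.
have P0 : P 0 0 = p by rewrite /P !scale0r !addr0 chart_mapK.
have jdir (g : M -> R) s r : `|s - 0| < e0 -> `|r - 0| < e0 ->
    has_pd phi j g (P s r) ->
    dwithin setT (fun s => g (P s r)) s (pd phi j g (P s r)).
  move=> sd rd; rewrite /P; have := inO s r sd rd.
  rewrite (_ : (fun s => _) =
    fun s => g (chart_inv phi (phi p + r *: e_ i + s *: e_ j))); last first.
    by apply/funext => s'; rewrite addrAC.
  by rewrite addrAC => rO; exact: pd_dwithin.
have mixed : dwithin setT Fs 0 (Frs 0 0).
  apply: (@mixed_derivative _ setT F Fr Frs Fs 0 0 e0) => //.
  - by rewrite dnbhs_withinT; exact: Proper_dnbhs_numFieldType.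
  - by move=> s r _ sd rd; apply: pd_dwithin (inO _ _ sd rd) _;
      apply: f3 => //; exact: inD.
  - by move=> s r _ sd rd; apply: jdir => //; apply: f7 => //; exact: inD.
  - by move=> r rd; apply: jdir => //; apply: f1 => //; exact: inD.
  - move=> e ep; have [d' d'0 dh] := cont_near (Ck_cont f8) Jt Dp ep.
    exists (d' / c); first by rewrite divr_gt0.
    move=> s r _ sd rd; rewrite /Frs P0; apply: dh => //; last exact: small.
    by rewrite subrr normr0.
have := @pd_dwithin (pd phi j (f t)) i (phi p + 0 *: e_ j) 0 (inO _ _ z0 z0).
rewrite -/(P 0 0) P0 => /(_ (f5 t p Jt Dp)).
by move/(dwithinT_unique mixed); rewrite /Frs P0.
Qed.
End ChartSchwarz.

(** * The differential ring of smooth functions *)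

Section SmoothRing.
Variables (R : realType) (n : nat) (M : topologicalType) (phi : chart R n M).
Variable T : R.
Local Notation D := (chart_dom phi).
Local Notation J := (`[0, T[%classic : set R).
Local Notation smooth := (time_smooth_on phi T J).

(** Functions are normalized to vanish outside [0, T[ x chart_dom, so that
    equality in the ring is equality of the values that matter. *)
Record smooth_fun := SmoothFun {
  smooth_val :> R -> M -> R;
  smooth_valP : smooth smooth_val;
  smooth_val0 : forall t p, ~ (J t /\ D p) -> smooth_val t p = 0 }.

Lemma smooth_ext (a b : smooth_fun) :
  (forall t p, J t -> D p -> a t p = b t p) -> a = b.
Proof.
move=> ab; have {}ab : smooth_val a = smooth_val b.
  apply/funext => t; apply/funext => p.
  have [[Jt Dp]|h] := pselect (J t /\ D p).
    exact: ab.
  by rewrite !smooth_val0.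
case: a b ab => [a aP a0] [b bP b0] /= ab; rewrite -ab in bP b0 *.
by congr SmoothFun; exact: Prop_irrelevance.
Qed.

Definition restr (f : R -> M -> R) t p : R :=
  if pselect (J t /\ D p) then f t p else 0.

Lemma restrE f t p : J t -> D p -> restr f t p = f t p.
Proof. by move=> Jt Dp; rewrite /restr; case: pselect => // -[]. Qed.

Lemma restr_smooth f : smooth f -> smooth (restr f).
Proof. by move=> fs k; apply: Ck_eq (fs k) => t p Jt Dp; rewrite restrE. Qed.

Lemma restr0 f t p : ~ (J t /\ D p) -> restr f t p = 0.
Proof. by rewrite /restr; case: pselect. Qed.

(** Elements of the ring are obtained from this opaque existence statement
    rather than by a transparent definition: this prevents conversion from
    unfolding nested ring operations and derivatives down to limits. *)
Lemma smooth_ex f : smooth f ->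
  {a : smooth_fun | forall t p, J t -> D p -> a t p = f t p}.
Proof.
by move=> fs; exists (SmoothFun (restr_smooth fs) (@restr0 f)) => t p;
  exact: restrE.
Qed.

HB.instance Definition _ := gen_eqMixin smooth_fun.
HB.instance Definition _ := gen_choiceMixin smooth_fun.

Fact smooth_cst r : smooth (fun _ _ => r).
Proof. by move=> k; exact: Ck_cst. Qed.
Fact smooth_add (a b : smooth_fun) : smooth (fun t p => a t p + b t p).
Proof. by move=> k; apply: CkD; exact: smooth_valP. Qed.
Fact smooth_opp (a : smooth_fun) : smooth (fun t p => - a t p).
Proof. by move=> k; apply: CkN; exact: smooth_valP. Qed.
Fact smooth_mul (a b : smooth_fun) : smooth (fun t p => a t p * b t p).
Proof. by move=> k; apply: CkM; exact: smooth_valP. Qed.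

Lemma smooth_const_ex r :
  {c : smooth_fun | forall t p, J t -> D p -> c t p = r}.
Proof. exact: smooth_ex (smooth_cst r). Qed.
Lemma smooth_add_ex (a b : smooth_fun) :
  {c : smooth_fun | forall t p, J t -> D p -> c t p = a t p + b t p}.
Proof. exact: smooth_ex (smooth_add a b). Qed.
Lemma smooth_opp_ex (a : smooth_fun) :
  {c : smooth_fun | forall t p, J t -> D p -> c t p = - a t p}.
Proof. exact: smooth_ex (smooth_opp a). Qed.
Lemma smooth_mul_ex (a b : smooth_fun) :
  {c : smooth_fun | forall t p, J t -> D p -> c t p = a t p * b t p}.
Proof. exact: smooth_ex (smooth_mul a b). Qed.

Definition smooth_const r := sval (smooth_const_ex r).
Definition smooth_addf a b := sval (smooth_add_ex a b).
Definition smooth_oppf a := sval (smooth_opp_ex a).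
Definition smooth_mulf a b := sval (smooth_mul_ex a b).

Lemma smooth_constE r t p : J t -> D p -> smooth_const r t p = r.
Proof. exact: (svalP (smooth_const_ex r)). Qed.
Let addfE a b t p : J t -> D p -> smooth_addf a b t p = a t p + b t p.
Proof. exact: (svalP (smooth_add_ex a b)). Qed.
Let oppfE a t p : J t -> D p -> smooth_oppf a t p = - a t p.
Proof. exact: (svalP (smooth_opp_ex a)). Qed.
Let mulfE a b t p : J t -> D p -> smooth_mulf a b t p = a t p * b t p.
Proof. exact: (svalP (smooth_mul_ex a b)). Qed.
Let opE := (addfE, oppfE, mulfE, smooth_constE).

Fact smooth_addA : associative smooth_addf.
Proof.
by move=> a b c; apply: smooth_ext => t p Jt Dp; rewrite !opE ?addrA.
Qed.
Fact smooth_addC : commutative smooth_addf.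
Proof.
by move=> a b; apply: smooth_ext => t p Jt Dp; rewrite !opE // addrC.
Qed.
Fact smooth_add0 : left_id (smooth_const 0) smooth_addf.
Proof. by move=> a; apply: smooth_ext => t p Jt Dp; rewrite !opE ?add0r. Qed.
Fact smooth_addN : left_inverse (smooth_const 0) smooth_oppf smooth_addf.
Proof. by move=> a; apply: smooth_ext => t p Jt Dp; rewrite !opE ?addNr. Qed.
HB.instance Definition _ := GRing.isZmodule.Build smooth_fun
  smooth_addA smooth_addC smooth_add0 smooth_addN.

Fact smooth_mulA : associative smooth_mulf.
Proof.
by move=> a b c; apply: smooth_ext => t p Jt Dp; rewrite !opE ?mulrA.
Qed.
Fact smooth_mulC : commutative smooth_mulf.
Proof.
by move=> a b; apply: smooth_ext => t p Jt Dp; rewrite !opE // mulrC.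
Qed.
Fact smooth_mul1 : left_id (smooth_const 1) smooth_mulf.
Proof. by move=> a; apply: smooth_ext => t p Jt Dp; rewrite !opE ?mul1r. Qed.
Fact smooth_mulDl : left_distributive smooth_mulf smooth_addf.
Proof.
by move=> a b c; apply: smooth_ext => t p Jt Dp; rewrite !opE ?mulrDl.
Qed.
HB.instance Definition _ := GRing.Zmodule_isComPzRing.Build smooth_fun
  smooth_mulA smooth_mulC smooth_mul1 smooth_mulDl.

Lemma smooth_addE (a b : smooth_fun) t p : J t -> D p ->
  (a + b) t p = a t p + b t p.
Proof. exact: addfE. Qed.
Lemma smooth_oppE (a : smooth_fun) t p : J t -> D p -> (- a) t p = - a t p.
Proof. exact: oppfE. Qed.
Lemma smooth_mulE (a b : smooth_fun) t p : J t -> D p ->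
  (a * b) t p = a t p * b t p.
Proof. exact: mulfE. Qed.

Definition ev t p of J t & D p := fun a : smooth_fun => a t p.

Arguments ev : simpl never.

Fact ev_zmod_morphism t p Jt Dp : zmod_morphism (@ev t p Jt Dp).
Proof. by move=> a b; rewrite /ev smooth_addE // smooth_oppE. Qed.
HB.instance Definition _ t p Jt Dp := GRing.isZmodMorphism.Build
  smooth_fun R (@ev t p Jt Dp) (ev_zmod_morphism Jt Dp).
Fact ev_monoid_morphism t p Jt Dp : monoid_morphism (@ev t p Jt Dp).
Proof.
by split=> [|a b]; rewrite /ev; [exact: smooth_constE|exact: smooth_mulE].
Qed.
HB.instance Definition _ t p Jt Dp := GRing.isMonoidMorphism.Build
  smooth_fun R (@ev t p Jt Dp) (ev_monoid_morphism Jt Dp).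

Section EvalRules.
Variables (t : R) (p : M) (Jt : J t) (Dp : D p).
Local Notation evp := (ev Jt Dp).

Lemma evD a b : evp (a + b) = evp a + evp b. Proof. exact: rmorphD. Qed.
Lemma evN a : evp (- a) = - evp a. Proof. exact: rmorphN. Qed.
Lemma evM a b : evp (a * b) = evp a * evp b. Proof. exact: rmorphM. Qed.
Lemma ev_sum m (F : 'I_m -> smooth_fun) :
  evp (\sum_i F i) = \sum_i evp (F i).
Proof. exact: rmorph_sum. Qed.
End EvalRules.

Fact smooth_pd i (a : smooth_fun) : smooth (fun t => pd phi i (a t)).
Proof. by move=> k; have [] := Ck_pd i (smooth_valP a k.+1). Qed.
Fact smooth_ddt (a : smooth_fun) : smooth (ddt T a).
Proof. by move=> k; have [] := Ck_ddt (smooth_valP a k.+1). Qed.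

Lemma space_ex i (a : smooth_fun) :
  {c : smooth_fun | forall t p, J t -> D p -> c t p = pd phi i (a t) p}.
Proof. exact: smooth_ex (smooth_pd i a). Qed.
Lemma time_ex (a : smooth_fun) :
  {c : smooth_fun | forall t p, J t -> D p -> c t p = ddt T a t p}.
Proof. exact: smooth_ex (smooth_ddt a). Qed.

Definition space_fun i a := sval (space_ex i a).
Definition time_fun a := sval (time_ex a).

Lemma space_funE i (a : smooth_fun) t p : J t -> D p ->
  space_fun i a t p = pd phi i (a t) p.
Proof. exact: (svalP (space_ex i a)). Qed.

Lemma time_funE (a : smooth_fun) t p : J t -> D p ->
  time_fun a t p = ddt T a t p.
Proof. exact: (svalP (time_ex a)). Qed.

Lemma smooth_has_pd i (a : smooth_fun) t p : J t -> D p ->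
  has_pd phi i (a t) p.
Proof. by have [h _] := Ck_pd i (smooth_valP a 1); exact: h. Qed.

Lemma smooth_is_ddt (a : smooth_fun) t p : J t -> D p ->
  is_ddt T a t p (ddt T a t p).
Proof. by have [h _] := Ck_ddt (smooth_valP a 1); exact: h. Qed.

Fact space_funD i : {morph space_fun i : a b / a + b}.
Proof.
move=> a b; apply: smooth_ext => t p Jt Dp.
rewrite smooth_addE // !space_funE //.
have [_ <-] := has_pdD (@smooth_has_pd i a t p Jt Dp)
                       (@smooth_has_pd i b t p Jt Dp).
by apply: eq_pd => // q Dq; rewrite smooth_addE.
Qed.

Fact space_funM i a b :
  space_fun i (a * b) = space_fun i a * b + a * space_fun i b.
Proof.
apply: smooth_ext => t p Jt Dp.
rewrite smooth_addE // !smooth_mulE // !space_funE //.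
have [_ <-] := has_pdM Dp (@smooth_has_pd i a t p Jt Dp)
                          (@smooth_has_pd i b t p Jt Dp).
by apply: eq_pd => // q Dq; rewrite smooth_mulE.
Qed.

Fact time_funD : {morph time_fun : a b / a + b}.
Proof.
move=> a b; apply: smooth_ext => t p Jt Dp.
rewrite smooth_addE // !time_funE //; apply: ddtE => //.
apply: is_ddt_eq
  (is_ddtD Jt (@smooth_is_ddt a t p Jt Dp) (@smooth_is_ddt b t p Jt Dp)) => //.
by move=> s Js; rewrite smooth_addE.
Qed.

Fact time_funM a b : time_fun (a * b) = time_fun a * b + a * time_fun b.
Proof.
apply: smooth_ext => t p Jt Dp.
rewrite smooth_addE // !smooth_mulE // !time_funE //; apply: ddtE => //.
apply: is_ddt_eq
  (is_ddtM Jt (@smooth_is_ddt a t p Jt Dp) (@smooth_is_ddt b t p Jt Dp)) => //.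
by move=> s Js; rewrite smooth_mulE.
Qed.

Definition Dspace i : deriv smooth_fun := Deriv (space_funD i) (space_funM i).
Definition Dtime : deriv smooth_fun := Deriv time_funD time_funM.

Lemma DspaceE i (a : smooth_fun) t p : J t -> D p ->
  Dspace i a t p = pd phi i (a t) p.
Proof. exact: space_funE. Qed.

Lemma DtimeE (a : smooth_fun) t p : J t -> D p -> Dtime a t p = ddt T a t p.
Proof. exact: time_funE. Qed.

Lemma DspaceC i j a : Dspace i (Dspace j a) = Dspace j (Dspace i a).
Proof.
have e k l t p : J t -> D p ->
    Dspace k (Dspace l a) t p = pd phi k (pd phi l (a t)) p.
  move=> Jt Dp; rewrite (DspaceE _ _ Jt Dp); apply: eq_pd => // q Dq.
  exact: DspaceE.
apply: smooth_ext => t p Jt Dp.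
transitivity (pd phi i (pd phi j (a t)) p); first exact: e.
rewrite (pd_pdC j i (smooth_valP a 2) Jt Dp); exact/esym/e.
Qed.

(** Holds up to the time 0, where the time derivative is one-sided. *)
Lemma DtimeC i a : Dtime (Dspace i a) = Dspace i (Dtime a).
Proof.
apply: smooth_ext => t p Jt Dp; rewrite (DtimeE _ Jt Dp) (DspaceE _ _ Jt Dp).
transitivity (pd phi i (ddt T a t) p); last first.
  by apply: eq_pd => // q Dq; rewrite DtimeE.
rewrite -(ddt_pdC i (smooth_valP a 2) Jt Dp); apply: ddtE => //.
have [_ h] := Ck_pd i (smooth_valP a 2); have [h' _] := Ck_ddt h.
apply: is_ddt_eq (h' t p Jt Dp) => // s Js.
by rewrite DspaceE.
Qed.

Lemma smooth_zeroE t p : J t -> D p -> (0 : smooth_fun) t p = 0.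
Proof. exact: smooth_constE. Qed.

Lemma Dspace_const i r : Dspace i (smooth_const r) = 0.
Proof.
apply: smooth_ext => t p Jt Dp; rewrite smooth_zeroE // DspaceE //.
rewrite -[RHS](has_pd_cst phi r i p).2.
by apply: eq_pd => // q Dq; rewrite smooth_constE.
Qed.

Lemma Dtime_const r : Dtime (smooth_const r) = 0.
Proof.
apply: smooth_ext => t p Jt Dp; rewrite smooth_zeroE // DtimeE //.
apply: ddtE => //; apply: is_ddt_eq (is_ddt_cst r p Jt) => //.
by move=> s Js; rewrite smooth_constE.
Qed.
End SmoothRing.

(** * Geometric quantities as elements of the ring *)

Section Transfer.
Variables (R : realType) (n : nat) (M : topologicalType) (phi : chart R n M).
Variable T : R.
Local Notation D := (chart_dom phi).
Local Notation J := (`[0, T[%classic : set R).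
Local Notation smooth := (time_smooth_on phi T J).
Local Notation A := (smooth_fun phi T).
Local Notation Ds := (Dspace phi T).
Variable gm : R -> M -> 'M[R]_n.
Hypothesis gm_smooth : forall i j, smooth (fun t p => gm t p i j).
Hypothesis gm_sym : forall t p, J t -> D p -> (gm t p)^T = gm t p.
Hypothesis gm_det : forall t p, J t -> D p -> \det (gm t p) != 0.

Definition metric_mx : 'M[A]_n :=
  \matrix_(i, j) sval (smooth_ex (gm_smooth i j)).
Local Notation Gm := metric_mx.

Lemma metric_mxE t p (Jt : J t) (Dp : D p) : map_mx (ev Jt Dp) Gm = gm t p.
Proof.
apply/matrixP => i j; rewrite !mxE /ev.
exact: (svalP (smooth_ex (gm_smooth i j))).
Qed.

Lemma metric_mx_sym : Gm^T = Gm.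
Proof.
apply/matrixP => i j; apply: smooth_ext => t p Jt Dp.
have e k l : Gm k l t p = gm t p k l by rewrite -(metric_mxE Jt Dp) [RHS]mxE.
by rewrite mxE !e -[in RHS](gm_sym Jt Dp) [RHS]mxE.
Qed.

Lemma det_metric_mx t p : J t -> D p -> (\det Gm) t p = \det (gm t p).
Proof. by move=> Jt Dp; rewrite -(metric_mxE Jt Dp) det_map_mx. Qed.

(** The determinant of the metric never vanishes, hence it is invertible in the
    ring. *)
Lemma inv_det_ex :
  {a : A | forall t p, J t -> D p -> a t p = ((\det Gm) t p)^-1}.
Proof.
apply: smooth_ex => k; apply: CkV; last exact: smooth_valP.
by move=> t p Jt Dp; rewrite det_metric_mx // gm_det.
Qed.

Definition inv_mx : 'M[A]_n := sval inv_det_ex *: \adj Gm.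
Local Notation hm := inv_mx.

Lemma inv_mxK : hm *m Gm = 1%:M.
Proof.
rewrite -scalemxAl mul_adj_mx scale_scalar_mx; congr (_%:M).
apply: smooth_ext => t p Jt Dp; rewrite smooth_mulE // (svalP inv_det_ex) //.
rewrite mulVf; first by rewrite smooth_constE.
by rewrite det_metric_mx // gm_det.
Qed.

Lemma inv_mxE t p (Jt : J t) (Dp : D p) :
  map_mx (ev Jt Dp) hm = invmx (gm t p).
Proof.
have : map_mx (ev Jt Dp) hm *m gm t p = 1%:M.
  by rewrite -(metric_mxE Jt Dp) -map_mxM inv_mxK map_mx1.
have gu : gm t p \in unitmx by rewrite unitmxE unitfE gm_det.
by move/(congr1 (mulmx^~ (invmx (gm t p)))); rewrite mulmxK // mul1mx.
Qed.

Definition one_half : A := smooth_const phi T 2^-1.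

Lemma one_half2 : one_half + one_half = 1.
Proof.
apply: smooth_ext => t p Jt Dp; rewrite smooth_addE // smooth_constE //.
by rewrite [RHS]smooth_constE //; lra.
Qed.

Local Notation agrees t F a := (forall q, D q -> F q = smooth_val a t q).

Section AtPoint.
Variables (t : R) (p : M) (Jt : J t) (Dp : D p).
Local Notation evp := (ev Jt Dp).

(** The bridge between the two sides: a function on M that agrees on the chart
    with a ring element at time t has the same partial derivatives. *)
Lemma pdE i F a : agrees t F a -> pd phi i F p = evp (Ds i a).
Proof. by move=> Fa; rewrite /ev DspaceE //; exact: eq_pd. Qed.

Lemma frob_ev (X B : 'M[A]_n) :
  evp (frob X B) = frob (map_mx evp X) (map_mx evp B).
Proof.
rewrite /frob ev_sum; apply: eq_bigr => i _; rewrite ev_sum.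
by apply: eq_bigr => j _; rewrite evM !mxE.
Qed.

(** Evaluation at a point of spacetime is a ring morphism, so it commutes with
    all contractions. *)
Lemma contr2_ev (h B C : 'M[A]_n) :
  evp (contr2 h B C) = contr2 (map_mx evp h) (map_mx evp B) (map_mx evp C).
Proof. by rewrite !contr2E frob_ev !map_mxM map_trmx. Qed.
End AtPoint.

Lemma christoffelE k i j t : J t ->
  agrees t (christoffel phi (gm t) k i j) (gamma Ds one_half Gm hm k i j).
Proof.
move=> Jt p Dp; rewrite -[RHS]/(ev Jt Dp _) /gamma evM ev_sum.
rewrite {1}/ev smooth_constE //; congr (_ * _); apply: eq_bigr => l _.
rewrite evM -(inv_mxE Jt Dp) mxE; congr (_ * _).
have e a b c : pd phi a (fun q => gm t q b c) p = ev Jt Dp (Ds a (Gm b c)).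
  by apply: pdE => q Dq; rewrite -(metric_mxE Jt Dq) mxE.
by rewrite !e -evN -!evD.
Qed.

Lemma riemannE l i j k t p (Jt : J t) (Dp : D p) :
  riemann phi (gm t) l i j k p = ev Jt Dp (curv Ds one_half Gm hm i j l k).
Proof.
have c a b d :
    christoffel phi (gm t) a b d p
    = ev Jt Dp (conn Ds one_half Gm hm b a d).
  by rewrite [conn _ _ _ _ _ _ _]mxE; exact: christoffelE.
have d a b e f : pd phi a (christoffel phi (gm t) b e f) p =
    ev Jt Dp (map_mx (Ds a) (conn Ds one_half Gm hm e) b f).
  rewrite [map_mx _ _ _ _]mxE [conn _ _ _ _ _ _ _]mxE.
  by apply: pdE => q; exact: christoffelE.
have m a b :
    ev Jt Dp ((conn Ds one_half Gm hm a *m conn Ds one_half Gm hm b) l k)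
    = \sum_m christoffel phi (gm t) l a m p * christoffel phi (gm t) m b k p.
  by rewrite mxE ev_sum; apply: eq_bigr => r _; rewrite evM !c.
rewrite /riemann sumrB -!m !d addrA -!evN -!evD; congr (ev _ _ _).
by rewrite /curv !(mxD_entry, mxN_entry).
Qed.

Section Geometry.
Variables (t : R) (p : M) (Jt : J t) (Dp : D p).
Local Notation evp := (ev Jt Dp).

Lemma ricciE : ricci phi (gm t) p = map_mx evp (ric Ds one_half Gm hm).
Proof.
apply/matrixP => j k; rewrite !mxE ev_sum; apply: eq_bigr => i _.
exact: riemannE.
Qed.

Lemma hessianE F (a : A) : agrees t F a ->
  hessian phi (gm t) F p = map_mx evp (hess Ds one_half Gm hm a).
Proof.
move=> Fa; apply/matrixP => i j; rewrite !mxE evD evN ev_sum; congr (_ - _).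
  by apply: pdE => q Dq; exact: pdE.
apply: eq_bigr => k _; rewrite evM christoffelE //.
by rewrite (pdE Jt Dp k Fa).
Qed.

Lemma tensor_traceE B :
  tensor_trace (gm t) p (map_mx evp B) = evp (frob hm B).
Proof. by rewrite frob_ev inv_mxE. Qed.

Lemma laplacianE F (a : A) : agrees t F a ->
  laplacian phi (gm t) F p = lap Ds one_half Gm hm a t p.
Proof. by move=> Fa; rewrite /laplacian (hessianE Fa) tensor_traceE. Qed.

Lemma scalar_curvE : scalar_curv phi (gm t) p = scal Ds one_half Gm hm t p.
Proof. by rewrite /scalar_curv ricciE tensor_traceE. Qed.

Lemma grad_dotE F1 F2 (a1 a2 : A) : agrees t F1 a1 -> agrees t F2 a2 ->
  grad_dot phi (gm t) F1 F2 p = gdot Ds hm a1 a2 t p.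
Proof.
move=> F1a F2a; rewrite -[RHS]/(evp _) /gdot ev_sum; apply: eq_bigr => i _.
rewrite ev_sum; apply: eq_bigr => j _; rewrite !evM -(inv_mxE Jt Dp).
by rewrite mxE (pdE Jt Dp i F1a) (pdE Jt Dp j F2a).
Qed.

Lemma grad_quadE F (a : A) : agrees t F a ->
  grad_quad phi (gm t) (ricci phi (gm t) p) F p =
  gquad Ds hm (ric Ds one_half Gm hm) a t p.
Proof.
move=> Fa; rewrite -[RHS]/(evp _) /gquad contr2_ev -ricciE inv_mxE.
apply: eq_bigr => i _; apply: eq_bigr => j _; apply: eq_bigr => k _.
apply: eq_bigr => l _; rewrite -mulrA; congr (_ * _).
by rewrite !mxE big_ord1 !mxE evM (pdE Jt Dp k Fa) (pdE Jt Dp l Fa).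
Qed.
End Geometry.
End Transfer.

(** * The evolution equation *)

Theorem lemma2p1 (R : realType) (n : nat) (M : topologicalType)
  (X : smooth_manifold R n M) (T : R) (g : metric_family X T)
  (g_flow : ricci_flow g)
  (c : R) (u : R -> M -> R)
  (u_smooth : forall phi, atlas X phi -> time_smooth_on phi T `[0, T[ u)
  (u_eq : forall phi t p, atlas X phi -> t \in `[0, T[ -> chart_dom phi p ->
    ddtau T u t p =
      laplacian phi (g phi t) (u t) p
      - grad_dot phi (g phi t) (u t) (u t) p
      - c * scalar_curv phi (g phi t) p)
  (alpha beta a b d lambda : R)
  (alpha_neq0 : alpha != 0) (alpha_neq_beta : 2 * alpha - 2 * beta != 0)
  (phi : chart R n M) (phi_atlas : atlas X phi) :
  let H : R -> M -> R := fun t p =>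
    alpha * laplacian phi (g phi t) (u t) p
    - beta * grad_dot phi (g phi t) (u t) (u t) p
    + a * scalar_curv phi (g phi t) p
    + b * (u t p / (T - t)) + d * (n%:R / (T - t)) in
  forall (t : R) (p : M), t \in `[0, T[ -> chart_dom phi p ->
  let tau := T - t in
  let G := g phi t in
  let Rc := ricci phi G in
  let Rs := scalar_curv phi G in
  has_ddt T H t p /\
  ddtau T H t p =
    laplacian phi G (H t) p
    - 2 * grad_dot phi G (H t) (u t) p
    - (2 * alpha - 2 * beta) *
        tensor_normsq G p
          (hessian phi G (u t) p
           + (alpha / (2 * alpha - 2 * beta)) *: Rc p
           - (lambda / (2 * tau)) *: G p)
    - (2 * alpha - 2 * beta) / alpha * (lambda / tau) * H t p
    - 2 * (alpha - 2 * beta) * grad_quad phi G (Rc p) (u t) p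
    + 2 * (a + beta * c) * grad_dot phi G Rs (u t) p
    + (2 * alpha - 2 * beta) * (n%:R * lambda ^+ 2 / (4 * tau ^+ 2))
    + (b - (2 * alpha - 2 * beta) / alpha * lambda * beta)
        * (grad_dot phi G (u t) (u t) p / tau)
    - (alpha * c + 2 * a) * laplacian phi G Rs p
    + (alpha ^+ 2 / (2 * alpha - 2 * beta) - 2 * a)
        * tensor_normsq G p (Rc p)
    + ((2 * alpha - 2 * beta) / alpha * lambda - 1) * b * (u t p / tau ^+ 2)
    + ((2 * alpha - 2 * beta) / alpha * lambda - 1) * d
        * (n%:R / tau ^+ 2)
    + ((2 * alpha - 2 * beta) / alpha * a * lambda - alpha * lambda - b * c)
        * (Rs p / tau).
Proof.
move=> H t p tJ Dp tau G Rc Rs.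
have Jt : `[0, T[%classic t by [].
pose J : set R := `[0, T[%classic.
have subJ s : J s -> s \in `[0, T].
  by rewrite /J /= !in_itv /= => /andP[-> /ltW].
have gm_smooth i j : time_smooth_on phi T J (fun t p => g phi t p i j).
  by move=> k; apply/time_Ck_restrict/metric_smooth.
have gm_sym s q : J s -> chart_dom phi q -> (g phi s q)^T = g phi s q.
  by move=> /subJ Js Dq; exact: Defs.metric_sym.
have gm_det s q : J s -> chart_dom phi q -> \det (g phi s q) != 0.
  (* A null vector of a positive definite matrix would have norm zero. *)
  move=> /subJ Js Dq; apply/det0P => -[v v0 vG].
  by have := metric_posdef g phi_atlas Js Dq v0; rewrite vG mul0mx mxE ltxx.
pose A := smooth_fun phi T; pose Ds := Dspace phi T; pose dt := Dtime phi T.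
pose Gm := metric_mx gm_smooth; pose hm := inv_mx gm_smooth gm_det.
pose half : A := one_half phi T; pose k r : A := smooth_const phi T r.
pose uA : A := sval (smooth_ex (u_smooth phi phi_atlas)).
have uAE s q : J s -> chart_dom phi q -> u s q = uA s q.
  by move=> Js Dq; rewrite (svalP (smooth_ex (u_smooth phi phi_atlas))).
have sigma_smooth : time_smooth_on phi T J (fun s _ => (T - s)^-1).
  move=> m; apply: CkV; last exact: CkD (Ck_cst _ _ _ T) (CkN (Ck_time _ _ _)).
  by move=> s q; rewrite /J /= in_itv /= => /andP[_ sT] _;
    rewrite subr_eq0 gt_eqF.
pose sigma : A := sval (smooth_ex sigma_smooth).
have sigmaE s q : J s -> chart_dom phi q -> sigma s q = (T - s)^-1.
  exact: (svalP (smooth_ex sigma_smooth)).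
have Ds_sigma i : Ds i sigma = 0.
  apply: smooth_ext => s q Js Dq; rewrite smooth_zeroE // DspaceE //.
  rewrite -[RHS](has_pd_cst phi (T - s)^-1 i q).2.
  by apply: eq_pd => // q' Dq'; rewrite sigmaE.
have dt_sigma : dt sigma = sigma * sigma.
  apply: smooth_ext => s q Js Dq; rewrite smooth_mulE // !sigmaE // DtimeE //.
  have h : is_ddt T (fun s (_ : M) => T - s) s q (0 - 1).
    apply: is_ddtD => //; first exact: is_ddt_cst.
    by apply: is_ddtN => //; exact: is_ddt_time.
  have T0 r : J r -> T - r != 0.
    by rewrite /J /= in_itv /= => /andP[_ rT]; rewrite subr_eq0 gt_eqF.
  apply: ddtE => //.
  have := is_ddtV Js (fun r Jr => T0 r Jr) h.
  rewrite sub0r opprK mul1r; apply: is_ddt_eq => // r Jr.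
  by rewrite sigmaE.
have Ac r : constant Ds dt (k r).
  by split=> [i|]; [exact: Dspace_const|exact: Dtime_const].
have halfD : half + half = 1 by exact: one_half2.
have Gsym : Gm^T = Gm by exact: metric_mx_sym.
have hG : hm *m Gm = 1%:M by exact: inv_mxK.
have DC i j x : Ds i (Ds j x) = Ds j (Ds i x) by exact: DspaceC.
have dtC i x : dt (Ds i x) = Ds i (dt x) by exact: DtimeC.
have GmE s q i j : J s -> chart_dom phi q -> Gm i j s q = g phi s q i j.
  by move=> Js Dq; rewrite -(metric_mxE gm_smooth Js Dq) [RHS]mxE.
have flow : map_mx dt Gm = - (ric Ds half Gm hm + ric Ds half Gm hm).
  apply/matrixP => i j; rewrite [LHS]mxE mxN_entry mxD_entry;
    apply: smooth_ext => s q Js Dq.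
  rewrite smooth_oppE // smooth_addE // DtimeE //.
  have ricE : ric Ds half Gm hm i j s q = ricci phi (g phi s) q i j.
    by rewrite (ricciE gm_smooth gm_det Js Dq) [RHS]mxE.
  rewrite ricE -mulr2n -mulr_natl -mulNr.
  rewrite -(g_flow phi s q phi_atlas (subJ s Js) Dq).
  have := smooth_is_ddt (a := Gm i j) Js Dq; rewrite -/J => h.
  apply/esym/ddtE => //; apply: is_ddt_eq h => // r Jr.
  by rewrite GmE.
have u_ddt s q : J s -> chart_dom phi q -> ddt T uA s q = ddt T u s q.
  move=> Js Dq; apply/esym/ddtE => //.
  have h := smooth_is_ddt (a := uA) Js Dq.
  by apply: is_ddt_eq h => // r Jr; rewrite uAE.
pose lapA := lap Ds half Gm hm; pose gdotA := gdot Ds hm.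
pose scalA := scal Ds half Gm hm; pose ricA := ric Ds half Gm hm.
have lapE s q F x : J s -> chart_dom phi q ->
    (forall q', chart_dom phi q' -> F q' = smooth_val x s q') ->
    laplacian phi (g phi s) F q = lapA x s q.
  by move=> Js Dq; exact: laplacianE.
have gdotE s q F1 F2 x y : J s -> chart_dom phi q ->
    (forall q', chart_dom phi q' -> F1 q' = smooth_val x s q') ->
    (forall q', chart_dom phi q' -> F2 q' = smooth_val y s q') ->
    grad_dot phi (g phi s) F1 F2 q = gdotA x y s q.
  by move=> Js Dq; exact: grad_dotE.
have scalE s q : J s -> chart_dom phi q ->
    scalar_curv phi (g phi s) q = scalA s q.
  by move=> Js Dq; exact: scalar_curvE.
have dt_u : dt uA = - (lapA uA - gdotA uA uA - k c * scalA).
  apply: smooth_ext => s q Js Dq; rewrite DtimeE // u_ddt // smooth_oppE //.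
  rewrite !smooth_addE // !smooth_oppE // smooth_mulE // smooth_constE //.
  have uE q' : chart_dom phi q' -> u s q' = uA s q' by exact: uAE.
  rewrite -(lapE s q (u s)) // -(gdotE s q (u s) (u s)) // -scalE //.
  by rewrite -(u_eq phi s q) // opprK.
pose HA : A := k alpha * lapA uA - k beta * gdotA uA uA + k a * scalA
  + k b * (uA * sigma) + k d * (k n%:R * sigma).
have HE s q : J s -> chart_dom phi q -> H s q = HA s q.
  move=> Js Dq; rewrite /H /HA.
  have uE q' : chart_dom phi q' -> u s q' = uA s q' by exact: uAE.
  rewrite (lapE s q (u s) uA) // (gdotE s q (u s) (u s) uA uA) // scalE //.
  move: (lapA uA) (gdotA uA uA) (scalA) => x y z.
  rewrite !smooth_addE // !smooth_oppE // !smooth_mulE // !smooth_constE //.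
  by rewrite sigmaE // uE.
have H_ddt : is_ddt T H t p (ddt T HA t p).
  have h := smooth_is_ddt (a := HA) Jt Dp.
  by apply: is_ddt_eq h => // r Jr; rewrite HE.
split; first exact: is_ddt_has H_ddt.
have := H_evolution DC halfD Gsym hG dtC flow
  (Ac c) (Ac alpha) (Ac beta) (Ac a) (Ac b) (Ac d) (Ac n%:R) Ds_sigma dt_sigma
    dt_u.
move=> /(congr1 (ev Jt Dp)).
rewrite -/half -/lapA -/gdotA -/scalA -/ricA -/HA.
have uE q : chart_dom phi q -> u t q = uA t q by exact: uAE.
have eL : laplacian phi G (H t) p = ev Jt Dp (lapA HA).
  by apply: lapE => // q Dq; exact: HE.
have eD : grad_dot phi G (H t) (u t) p = ev Jt Dp (gdotA HA uA).
  by apply: gdotE => // q Dq; exact: HE.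
have eQ : grad_quad phi G (Rc p) (u t) p = ev Jt Dp (gquad Ds hm ricA uA).
  exact: grad_quadE.
have eRs q : chart_dom phi q -> Rs q = scalA t q by exact: scalE.
have eR : Rs p = ev Jt Dp scalA by exact: eRs.
have eRu : grad_dot phi G Rs (u t) p = ev Jt Dp (gdotA scalA uA).
  exact: gdotE.
have eLR : laplacian phi G Rs p = ev Jt Dp (lapA scalA) by exact: lapE.
have eu : u t p = ev Jt Dp uA by exact: uE.
have euu : grad_dot phi G (u t) (u t) p = ev Jt Dp (gdotA uA uA).
  exact: gdotE.
have eLu : laplacian phi G (u t) p = ev Jt Dp (lapA uA) by exact: lapE.
have es : ev Jt Dp sigma = tau^-1 by exact: sigmaE.
have ek r : ev Jt Dp (k r) = r by exact: smooth_constE.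
have hmE : map_mx (ev Jt Dp) hm = invmx (G p) by exact: inv_mxE.
have RcE : Rc p = map_mx (ev Jt Dp) ricA by exact: ricciE.
pose U := hessian phi G (u t) p.
have UE : U = map_mx (ev Jt Dp) (hess Ds half Gm hm uA) by exact: hessianE.
have eNR : contr2 (invmx (G p)) (Rc p) (Rc p) = ev Jt Dp (contr2 hm ricA ricA).
  by rewrite contr2_ev hmE -RcE.
have eNU : contr2 (invmx (G p)) U U
    = ev Jt Dp (contr2 hm (hess Ds half Gm hm uA) (hess Ds half Gm hm uA)).
  by rewrite contr2_ev hmE -UE.
have eNRU : contr2 (invmx (G p)) (Rc p) U
    = ev Jt Dp (contr2 hm ricA (hess Ds half Gm hm uA)).
  by rewrite contr2_ev hmE -UE -RcE.
have Gunit : invmx (G p) *m G p = 1%:M.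
  by rewrite mulVmx // unitmxE unitfE gm_det.
have eH : H t p = alpha * laplacian phi G (u t) p
    - beta * grad_dot phi G (u t) (u t) p + a * Rs p + b * (u t p / tau)
    + d * (n%:R / tau) by [].
have eT B : tensor_normsq G p B = contr2 (invmx (G p)) B B by [].
have eLf : frob (invmx (G p)) U = laplacian phi G (u t) p by [].
have eRf : frob (invmx (G p)) (Rc p) = Rs p by [].
have tau0 : tau != 0.
  by move: tJ; rewrite in_itv /= subr_eq0 => /andP[_ tT]; rewrite gt_eqF.
have Hdt : ddtau T H t p = - ev Jt Dp (dt HA).
  by rewrite /ddtau (ddtE tJ H_ddt) /ev DtimeE.
rewrite Hdt !eT (contr2_shift U _ _ _ (gm_sym t p Jt Dp) Gunit) eH.
rewrite eLf eRf eNR eNU eNRU eL eD eQ eR eRu eLR euu eLu eu.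
clear -es ek tau0 alpha_neq0 alpha_neq_beta.
have e2 : ev Jt Dp 2 = 2 by exact: rmorph_nat.
(* What remains is an identity between rational functions of these values:
   forget their definitions, push the evaluation to the atoms and compute in R.
   *)
move: (lapA HA) (gdotA HA uA) (contr2 hm ricA ricA)
  (contr2 hm ricA (hess Ds half Gm hm uA))
  (contr2 hm (hess Ds half Gm hm uA) (hess Ds half Gm hm uA))
  (gquad Ds hm ricA uA) (gdotA scalA uA) (lapA scalA) (gdotA uA uA) (lapA uA)
  (dt HA) => x1 x2 x3 x4 x5 x6 x7 x8 x9 x10 x11.
move: es ek; move: (k) (sigma) (uA) (scalA) => k' y1 y2 y3 es ek.
rewrite !expr2 !(evD, evN, evM, e2, ek, es) => ->.
by field; rewrite tau0 alpha_neq_beta alpha_neq0.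
Qed.
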